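(* The restriction $\det|_{\mathcal{F}_s(h^1,l^2)}$ of the determinant line bundle to the space of self-adjoint Fredholm operators $l^2\supset h^1\to l^2$ is non-orientable.
   Context: $l^2=\{x=(x_n)_{n\in\mathbb{Z}}\mid x_n\in\mathbb{R},\ \sum_nx_n^2<\infty\}$ with $\langle x,y\rangle=\sum_nx_ny_n$, and $h^1=\{x=(x_n)_{n\in\mathbb{Z}}\mid x_n\in\mathbb{R},\ \sum_nn^2x_n^2<\infty\}$ with $\langle x,y\rangle_{h^1}=\sum_nx_ny_n+\sum_nn^2x_ny_n$, are real Hilbert spaces. $\mathcal{F}_s(h^1,l^2)$ is the space (with operator norm topology from $\mathcal{L}(h^1,l^2)$) of Fredholm operators $T:h^1\to l^2$ that are self-adjoint as unbounded operators on $l^2$ with domain $h^1$; equivalently, that have index zero and are symmetric, $\langle Tx,y\rangle=\langle x,Ty\rangle$ for $x,y\in h^1$. Determinant line bundle: for Banach spaces $X,Y$ and a Fredholm operator $D:X\to Y$ with adjoint $D^*$ on the dual spaces, $\det(D)=\Lambda^{\max}(\ker D^* )\otimes\Lambda^{\max}(\ker D)$. These lines form a real line bundle over the space $\mathcal{F}(X,Y)$ of Fredholm operators as follows. Given $T$, $N=\dim\mathrm{coker}\,T$, and an isomorphism $\Phi$ from $\mathbb{R}^N$ onto a complement of $\mathrm{im}\,T$, the operator $D\oplus\Phi:X\oplus\mathbb{R}^N\to Y$, $(x,\zeta)\mapsto Dx+\Phi\zeta$, is surjective for $D$ in a neighbourhood of $T$. For such $D$ with $k=\dim\ker D$, $l=\dim\mathrm{coker}\,D$,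 let $x_1,\dots,x_k$ be a basis of $\ker D$, $y_1^*,\dots,y_l^*$ a basis of $\ker D^*$, and choose a basis $\zeta_1,\dots,\zeta_N$ of $\mathbb{R}^N$ and $\xi_{l+1},\dots,\xi_N\in X$ with $D\xi_j+\Phi\zeta_j=0$ for $j=l+1,\dots,N$. The map $\iota_\Phi(D,\cdot):\det(D)\to\Lambda^{\max}\ker(D\oplus\Phi)$ sends $(y_l^*\wedge\dots\wedge y_1^* )\otimes(x_1\wedge\dots\wedge x_k)$ to $$(-1)^{kl}\frac{\det(\langle y_j^*,\Phi\zeta_i\rangle)_{i,j=1}^l}{\det(\zeta_1,\dots,\zeta_N)}(x_1,0)\wedge\dots\wedge(x_k,0)\wedge(\xi_{l+1},\zeta_{l+1})\wedge\dots\wedge(\xi_N,\zeta_N),$$ and the bundle structure is the one for which all $\iota_\Phi$ are line bundle isomorphisms onto the top exterior power of the kernel bundle of $D\oplus\Phi$. *)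

(* Defs.v *)
From HB Require Import structures.
From mathcomp Require Import all_boot all_order all_algebra.
From mathcomp Require Import all_classical all_reals.
From mathcomp Require Import topology normedtype sequences.
From mathcomp Require Import ring lra.

Set Implicit Arguments.
Unset Strict Implicit.
Unset Printing Implicit Defensive.

Import Order.TTheory GRing.Theory Num.Theory.
Import numFieldNormedType.Exports.

Local Open Scope classical_set_scope.
Local Open Scope ring_scope.

Section BoundedOperators.
Context {R : realType} (X Y : normedModType R).

Definition bounded_linear : {pred X -> Y} := fun T =>
  `[< linear T /\ exists M : R, forall x, `|T x| <= M * `|x| >].

Fact bounded_linear_submod_closed : submod_closed bounded_linear.
Proof.
split.
  apply/asboolP; split.
    by move=> a x y; rewrite /= scaler0 addr0.
  by exists 0 => x; rewrite mul0r normr0.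
move=> a S T /asboolP[linS [M SM]] /asboolP[linT [M' TM]].
apply/asboolP; split.
  move=> b x y; rewrite !fctE linS linT !scalerDr !scalerA.
  by rewrite (mulrC a b) -!addrA; congr (_ + _); rewrite addrCA.
exists (`|a| * M + M') => x; rewrite !fctE.
rewrite (le_trans (ler_normD _ _))// mulrDl lerD//.
by rewrite normrZ -mulrA ler_wpM2l.
Qed.

HB.instance Definition _ :=
  GRing.isSubmodClosed.Build R (X -> Y) bounded_linear
    bounded_linear_submod_closed.

Record blin := Blin {
  blin_fun :> X -> Y;
  blin_subproof : blin_fun \in bounded_linear }.

HB.instance Definition _ := [isSub for blin_fun].
HB.instance Definition _ := [Choice of blin by <:].
HB.instance Definition _ := [SubChoice_isSubLmodule of blin by <:].

Lemma blinP (T : blin) :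
  linear T /\ exists M : R, forall x, `|T x| <= M * `|x|.
Proof. by case: T => T /= /asboolP. Qed.

HB.instance Definition _ (T : blin) :=
  GRing.isLinear.Build R X Y *:%R (blin_fun T) (blinP T).1.

Definition opnorm (T : blin) : R :=
  sup [set `|T x| | x in [set x : X | `|x| <= 1]].

Lemma opnorm_has_sup (T : blin) :
  has_sup [set `|T x| | x in [set x : X | `|x| <= 1]].
Proof.
split; first by exists `|T 0|, 0 => //=; rewrite normr0 ler01.
have [_ [M TM]] := blinP T; exists (Num.max M 0) => _ [x /= x1 <-].
rewrite (le_trans (TM x))// (@le_trans _ _ (Num.max M 0 * `|x|))//.
  by rewrite ler_wpM2r// le_max lexx.
by rewrite ler_piMr// le_max lexx orbT.
Qed.

Lemma le_opnorm (T : blin) x : `|T x| <= opnorm T * `|x|.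
Proof.
have [->|x0] := eqVneq x 0; first by rewrite linear0 !normr0 mulr0.
have nx : 0 < `|x| by rewrite normr_gt0.
rewrite -ler_pdivrMr// -[X in _ / X](normr_id x) -normfV -[leLHS]/(_ * _) mulrC.
rewrite -normrZ -linearZ/=; apply: ub_le_sup; first by case: (opnorm_has_sup T).
exists (`|x|^-1 *: x) => //=.
by rewrite normrZ normfV normr_id mulVf// gt_eqF.
Qed.

Lemma opnorm_le (T : blin) M :
  (forall x, `|x| <= 1 -> `|T x| <= M) -> opnorm T <= M.
Proof.
move=> TM; apply: ge_sup; first by case: (opnorm_has_sup T).
by move=> _ [x /= x1 <-]; exact: TM.
Qed.

Lemma opnorm_ge0 T : 0 <= opnorm T.
Proof.
have /(_ 0) := ub_le_sup (opnorm_has_sup T).2; apply.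
by exists 0; rewrite ?linear0 /= normr0.
Qed.

Fact ler_opnormD S T : opnorm (S + T) <= opnorm S + opnorm T.
Proof.
apply: opnorm_le => x x1.
rewrite (le_trans (ler_normD (S x) (T x)))// lerD//.
  by rewrite (le_trans (le_opnorm _ _))// ler_piMr// opnorm_ge0.
by rewrite (le_trans (le_opnorm _ _))// ler_piMr// opnorm_ge0.
Qed.

Let opnormZ_le a T : opnorm (a *: T) <= `|a| * opnorm T.
Proof.
apply: opnorm_le => x x1; rewrite normrZ ler_wpM2l//.
by rewrite (le_trans (le_opnorm _ _))// ler_piMr// opnorm_ge0.
Qed.

Fact opnormZ a T : opnorm (a *: T) = `|a| * opnorm T.
Proof.
apply/eqP; rewrite eq_le opnormZ_le/=.
have [->|a0] := eqVneq a 0; first by rewrite normr0 mul0r opnorm_ge0.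
rewrite mulrC -ler_pdivlMr ?normr_gt0// mulrC -normfV.
by rewrite -[in leLHS](scale1r T) -(mulVf a0) -scalerA opnormZ_le.
Qed.

Fact opnorm_eq0 T : opnorm T = 0 -> T = 0.
Proof.
move=> T0; apply/val_inj/funext => x; apply/eqP; rewrite -normr_le0.
by rewrite (le_trans (le_opnorm T x))// T0 mul0r.
Qed.

HB.instance Definition _ :=
  Lmodule_isNormed.Build R blin ler_opnormD opnormZ opnorm_eq0.

End BoundedOperators.

(* A series over the integers is folded into a series over the naturals:
   [Posz i] is i and [Negz i] is - (i + 1). It is only used for sequences with
   nonnegative terms, where convergence is unconditional, and for products of
   two square-summable sequences, which converge absolutely. *)
Section IntegerSeries.
Context {R : realType}.
Implicit Types (u v x y : int -> R).

Definition zfold u : R^nat := fun i => u (Posz i) + u (Negz i).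

Definition zcvg u : Prop := cvgn (series (zfold u)).

Definition zsum u : R := limn (series (zfold u)).

Definition dot x y : R := zsum (fun n => x n * y n).

Lemma eq_zcvg u v : u =1 v -> zcvg u -> zcvg v.
Proof. by move=> /funext ->. Qed.

Lemma eq_zsum u v : u =1 v -> zsum u = zsum v.
Proof. by move=> /funext ->. Qed.

Let zfoldD u v : zfold (fun n => u n + v n) = zfold u \+ zfold v.
Proof. by apply/funext => i; rewrite /zfold /= addrACA. Qed.

Let zfoldZ a u : zfold (fun n => a * u n) = a *: zfold u.
Proof. by apply/funext => i; rewrite /zfold -mulrDr. Qed.

Lemma zcvgD u v : zcvg u -> zcvg v -> zcvg (fun n => u n + v n).
Proof. by rewrite /zcvg zfoldD; exact: is_cvg_seriesD. Qed.

Lemma zsumD u v : zcvg u -> zcvg v ->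
  zsum (fun n => u n + v n) = zsum u + zsum v.
Proof. by rewrite /zsum zfoldD; exact: lim_seriesD. Qed.

Lemma zcvgZ a u : zcvg u -> zcvg (fun n => a * u n).
Proof. by rewrite /zcvg zfoldZ; exact: is_cvg_seriesZ. Qed.

Lemma zsumZ a u : zcvg u -> zsum (fun n => a * u n) = a * zsum u.
Proof. by rewrite /zsum zfoldZ; exact: lim_seriesZ. Qed.

Lemma zcvg_le u v : (forall n, 0 <= u n <= v n) -> zcvg v -> zcvg u.
Proof.
move=> uv; apply: series_le_cvg => i; rewrite /zfold ?addr_ge0//.
- by have /andP[] := uv (Posz i).
- by have /andP[] := uv (Negz i).
- by have /andP[/le_trans h /h] := uv (Posz i).
- by have /andP[/le_trans h /h] := uv (Negz i).
- by rewrite lerD//; [have /andP[] := uv (Posz i)|have /andP[] := uv (Negz i)].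
Qed.

Section Nonnegative.
Variable u : int -> R.
Hypothesis u0 : forall n, 0 <= u n.

Let nd_series : nondecreasing_seq (series (zfold u)).
Proof. by apply: nondecreasing_series => i _ _; rewrite addr_ge0. Qed.

Lemma zsum_partial_le N : zcvg u -> series (zfold u) N <= zsum u.
Proof. by move=> cu; exact: nondecreasing_cvgn_le. Qed.

Lemma zsum_bounded M : (forall N, series (zfold u) N <= M) ->
  zcvg u /\ zsum u <= M.
Proof.
move=> uM; have cu : zcvg u.
  apply: nondecreasing_is_cvgn => //.
  by exists M => _ [N _ <-]; exact: uM.
by split=> //; apply: limr_le => //; exact: nearW.
Qed.

Lemma zsum_ge0 : zcvg u -> 0 <= zsum u.
Proof.
by move=> /(zsum_partial_le 0); rewrite /series /= big_geq.
Qed.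

Lemma zsum_term_le n : zcvg u -> u n <= zsum u.
Proof.
move=> cu.
have [i ui] : exists i, u n <= zfold u i.
  by case: n => i; exists i; rewrite /zfold ?lerDl ?lerDr.
apply: (le_trans ui); apply: le_trans (zsum_partial_le i.+1 cu).
rewrite seriesEord/= big_ord_recr/= lerDr sumr_ge0// => j _.
by rewrite addr_ge0.
Qed.

Lemma zsum_eq0 : zcvg u -> zsum u = 0 -> forall n, u n = 0.
Proof.
move=> cu su n; apply/eqP; rewrite eq_le u0 andbT -su.
exact: zsum_term_le.
Qed.

End Nonnegative.

Definition sqsummable : {pred int -> R} := fun x =>
  `[< zcvg (fun n => x n ^+ 2) >].

Fact sqsummable_submod_closed : submod_closed sqsummable.
Proof.
split.
  apply/asboolP; rewrite /zcvg.
  have -> : series (zfold (fun n => (0 : int -> R) n ^+ 2)) = fun=> 0.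
    apply/funext => N; rewrite seriesEord /= big1// => i _.
    by rewrite /zfold expr0n addr0.
  exact: is_cvg_cst.
move=> a x y /asboolP cx /asboolP cy; apply/asboolP.
apply: (@zcvg_le _ (fun n => (2 * a ^+ 2) * x n ^+ 2 + 2 * y n ^+ 2)).
  move=> n; rewrite !fctE sqr_ge0/= -[a *: x n]/(a * x n).
  by have := sqr_ge0 (a * x n - y n); lra.
by apply: zcvgD; exact: zcvgZ.
Qed.

Lemma zcvg_dot x y : zcvg (fun n => x n ^+ 2) -> zcvg (fun n => y n ^+ 2) ->
  zcvg (fun n => x n * y n).
Proof.
move=> cx cy.
have cxy : zcvg (fun n => (x n + y n) ^+ 2).
  apply: (@zcvg_le _ (fun n => 2 * x n ^+ 2 + 2 * y n ^+ 2)) => [n|].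
    by rewrite sqr_ge0/=; have := sqr_ge0 (x n - y n); lra.
  by apply: zcvgD; exact: zcvgZ.
apply: (@eq_zcvg (fun n => 2^-1 * (x n + y n) ^+ 2
  + (- 2^-1 * x n ^+ 2 + - 2^-1 * y n ^+ 2))) => [n|].
  by field.
by apply: zcvgD; [|apply: zcvgD]; exact: zcvgZ.
Qed.

Lemma dotC x y : dot x y = dot y x.
Proof. by apply: eq_zsum => n; rewrite mulrC. Qed.

End IntegerSeries.

HB.instance Definition _ (R : realType) :=
  GRing.isSubmodClosed.Build R (int -> R) (@sqsummable R)
    (@sqsummable_submod_closed R).

Record l2 (R : realType) := L2 {
  l2_val :> int -> R;
  l2_subproof : l2_val \in @sqsummable R }.

Section L2.
Context {R : realType}.

HB.instance Definition _ := [isSub for @l2_val R].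
HB.instance Definition _ := [Choice of l2 R by <:].
HB.instance Definition _ := [SubChoice_isSubLmodule of l2 R by <:].

Implicit Types (x y z : l2 R) (a : R).

Lemma l2P x : zcvg (fun n => x n ^+ 2).
Proof. by case: x => x /= /asboolP. Qed.

Definition l2norm x : R := Num.sqrt (dot x x).

Lemma l2_cvg x y : zcvg (fun n => x n * y n).
Proof. by apply: zcvg_dot; exact: l2P. Qed.

Lemma dotDr x y z : dot x (y + z) = dot x y + dot x z.
Proof.
rewrite -(zsumD (@l2_cvg _ _) (@l2_cvg _ _)).
by apply: eq_zsum => n; rewrite -mulrDr.
Qed.

Lemma dotZr a x y : dot x (a *: y) = a * dot x y.
Proof.
rewrite -(zsumZ _ (@l2_cvg _ _)); apply: eq_zsum => n.
by rewrite mulrCA.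
Qed.

Lemma dotDl x y z : dot (x + y) z = dot x z + dot y z.
Proof. by rewrite dotC dotDr ![dot z _]dotC. Qed.

Lemma dotZl a x y : dot (a *: x) y = a * dot x y.
Proof. by rewrite dotC dotZr dotC. Qed.

Lemma dot_ge0 x : 0 <= dot x x.
Proof.
by apply: zsum_ge0 => [n|]; [rewrite -expr2 sqr_ge0|exact: l2_cvg].
Qed.

Lemma dot_eq0 x : dot x x = 0 -> x = 0.
Proof.
move=> x0; apply/val_inj/funext => n; apply/eqP; rewrite -sqrf_eq0 expr2.
apply/eqP; apply: zsum_eq0 x0 n => [n|]; first by rewrite -expr2 sqr_ge0.
exact: l2_cvg.
Qed.

Lemma dot_CauchySchwarz x y : dot x y ^+ 2 <= dot x x * dot y y.
Proof.
have [y0|ypos] := eqVneq (dot y y) 0.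
  rewrite (dot_eq0 y0) -(scale0r y) !dotZr !mul0r mulr0.
  by rewrite expr0n.
have {}ypos : 0 < dot y y by rewrite lt_neqAle eq_sym ypos dot_ge0.
have := dot_ge0 (dot y y *: x + (- dot x y) *: y).
rewrite !(dotDr, dotDl, dotZr, dotZl) (dotC y x) => h.
rewrite -subr_ge0 -(pmulr_rge0 _ ypos).
by apply: le_trans h _; rewrite le_eqVlt; apply/orP; left; apply/eqP; ring.
Qed.

Fact ler_l2normD x y : l2norm (x + y) <= l2norm x + l2norm y.
Proof.
rewrite -[leRHS]ger0_norm ?addr_ge0 ?sqrtr_ge0// -sqrtr_sqr ler_sqrt ?sqr_ge0//.
rewrite sqrrD !sqr_sqrtr ?dot_ge0// -sqrtrM ?dot_ge0//.
rewrite !(dotDr, dotDl) (dotC y x).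
have : dot x y <= Num.sqrt (dot x x * dot y y).
  rewrite (le_trans (ler_norm _))// -sqrtr_sqr ler_sqrt ?dot_CauchySchwarz//.
  by rewrite mulr_ge0 ?dot_ge0.
lra.
Qed.

Fact l2normZ a x : l2norm (a *: x) = `|a| * l2norm x.
Proof.
by rewrite /l2norm dotZr dotZl mulrA -expr2 sqrtrM ?sqr_ge0// sqrtr_sqr.
Qed.

Fact l2norm_eq0 x : l2norm x = 0 -> x = 0.
Proof.
move=> /eqP; rewrite sqrtr_eq0 => x0; apply: dot_eq0.
by apply/eqP; rewrite eq_le x0 dot_ge0.
Qed.

HB.instance Definition _ :=
  Lmodule_isNormed.Build R (l2 R) ler_l2normD l2normZ l2norm_eq0.

Lemma l2_coord_le x n : `|x n| <= `|x|.
Proof.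
rewrite -[leLHS]sqrtr_sqr -[`|x|]/(Num.sqrt _) ler_sqrt ?dot_ge0//.
have := @zsum_term_le _ (fun n => x n * x n) _ n (@l2_cvg x x).
by rewrite expr2; apply => m; rewrite -expr2 sqr_ge0.
Qed.

Lemma l2_partial_le x N : series (zfold (fun n => x n ^+ 2)) N <= `|x| ^+ 2.
Proof.
rewrite -[`|x|]/(Num.sqrt _) sqr_sqrtr ?dot_ge0//.
by apply: zsum_partial_le => [n|]; [exact: sqr_ge0|exact: l2P].
Qed.

Lemma l2_complete (F : set_system (l2 R)) : ProperFilter F ->
  cauchy F -> cvg F.
Proof.
move=> FF /cauchyP Fc.
have coord n : cvg ((fun x : l2 R => x n) @ F).
  apply: cauchy_cvg; apply/cauchyP => e e0.
  have [y Fy] := Fc e e0; exists (y n).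
  rewrite nbhs_filterE /= -[X in F X]/[set x : l2 R | ball (y n) e (x n)].
  apply: (filterS _ Fy) => x; rewrite -!ball_normE /= => yx.
  exact: (le_lt_trans (l2_coord_le (y - x) n) yx).
pose xl n := lim ((fun x : l2 R => x n) @ F).
have near_xl e : 0 < e -> forall y, F (ball y e) ->
    exists z : l2 R, (forall n, z n = y n - xl n) /\ `|z| <= e.
  move=> e0 y Fy.
  have /zsum_bounded : forall n, 0 <= (y n - xl n) ^+ 2.
    by move=> n; exact: sqr_ge0.
  move=> /(_ (e ^+ 2)) [N|cz sz].
    have cvS : series (zfold (fun n => (y n - x n) ^+ 2)) N @[x --> F]
        --> series (zfold (fun n => (y n - xl n) ^+ 2)) N.
      have cv1 n : y n - x n @[x --> F] --> y n - xl n.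
        by apply: cvgB; [exact: cvg_cst|exact: coord].
      have cv2 n : (y n - x n) ^+ 2 @[x --> F] --> (y n - xl n) ^+ 2.
        exact: cvgM (cv1 n) (cv1 n).
      elim: N => [|N ihN].
        by rewrite /series /=; under eq_fun do rewrite big_geq//;
          rewrite big_geq//; exact: cvg_cst.
      rewrite seriesSr; under eq_fun do rewrite seriesSr.
      by apply: cvgD => //; exact: cvgD.
    apply: (closed_cvg (fun r => r <= e ^+ 2) _ _ _ cvS); first exact: closed_le.
    apply: (@filterS _ F _ (ball y e) _ _ Fy) => x.
    rewrite -ball_normE /= => yx.
    apply: le_trans (l2_partial_le (y - x) N) _.
    by rewrite ler_sqr ?nnegrE// ltW.
  have zin : (fun n => y n - xl n) \in @sqsummable R by apply/asboolP.
  exists (L2 zin); split => //.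
  rewrite -[`|_|]/(Num.sqrt _) -(ger0_norm (ltW e0)) -sqrtr_sqr ler_sqrt//.
  exact: sqr_ge0.
have [y0 Fy0] := Fc 1 ltr01.
have [z0 [z0E _]] := near_xl _ ltr01 _ Fy0.
apply/cvg_ex; exists (y0 - z0).
apply/cvgrPdist_lt => e e0.
have e2 : 0 < e / 2 by rewrite divr_gt0.
have [y Fy] := Fc _ e2.
have [z [zE ze]] := near_xl _ e2 _ Fy.
have yz : y0 - z0 = y - z.
  apply/val_inj/funext => n.
  by rewrite -[LHS]/(y0 n - z0 n) -[RHS]/(y n - z n) z0E zE !subKr.
rewrite yz; apply: (@filterS _ F _ (ball y (e / 2)) _ _ Fy) => x.
rewrite -ball_normE /= => yx.
rewrite addrAC (le_lt_trans (ler_normB _ _))//.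
by rewrite [ltRHS]splitr ltr_leD.
Qed.

HB.instance Definition _ := Uniform_isComplete.Build (l2 R) l2_complete.

End L2.

Section H1.
Context {R : realType}.


Definition h1dot (x y : int -> R) : R :=
  dot x y + zsum (fun n => n%:~R ^+ 2 * (x n * y n)).

(* The condition on [x] is only that the sum of the n^2 x_n^2 is finite. *)
Definition h1summable : {pred int -> R} := fun x =>
  `[< zcvg (fun n => n%:~R ^+ 2 * x n ^+ 2) >].

(* [x] is in [h1] iff the sequence of the (1 + n^2)^(1/2) x_n is in [l2], and
   the norms agree. *)
Let w (n : int) : R := Num.sqrt (1 + n%:~R ^+ 2).

Let w2 n : w n ^+ 2 = 1 + n%:~R ^+ 2.
Proof. by rewrite sqr_sqrtr// addr_ge0// sqr_ge0. Qed.

Let w_neq0 n : w n != 0.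
Proof. by rewrite -sqrf_eq0 w2 gt_eqF// ltr_pwDl// sqr_ge0. Qed.

Let zcvg_delta0 (c : R) : 0 <= c -> zcvg (fun n => if n == 0 then c else 0).
Proof.
move=> c0; apply: (proj1 (@zsum_bounded _ _ _ c _)) => [n|N].
  by case: ifP.
rewrite seriesEord /=; case: N => [|N]; first by rewrite big_ord0.
by rewrite big_ord_recl big1 /= => [|i _]; rewrite /zfold /= ?addr0.
Qed.

Let h1_l2 x : (x \in h1summable) = ((fun n => w n * x n) \in @sqsummable R).
Proof.
apply/asboolP/asboolP => cx.
  apply: (@zcvg_le _ _ (fun n => 2 * (n%:~R ^+ 2 * x n ^+ 2) +
    (if n == 0 then x 0 ^+ 2 else 0))).
    move=> n; rewrite sqr_ge0 /= exprMn w2.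
    have [->|n0] := eqVneq n 0; first by rewrite mulr0z expr0n /=; lra.
    rewrite addr0 mulrDl mul1r mulr2n mulrDl mul1r lerD2r ler_peMl ?sqr_ge0//.
    by rewrite -rmorphXn ler1z -gtz0_ge1 exprn_even_gt0.
  by apply: zcvgD; [exact: zcvgZ|exact: zcvg_delta0 (sqr_ge0 _)].
apply: zcvg_le cx => n; rewrite mulr_ge0 ?sqr_ge0//= exprMn w2 mulrDl lerDr.
by rewrite mul1r sqr_ge0.
Qed.

Fact h1summable_submod_closed : submod_closed h1summable.
Proof.
have [l0 ll] := @sqsummable_submod_closed R; split.
  rewrite h1_l2 (_ : (fun _ => _) = 0)//.
  by apply/funext => n; exact: mulr0.
move=> a x y; rewrite !h1_l2 => /ll + /[dup] => /(_ a) /[apply] axy _.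
rewrite (_ : (fun _ => _) = a *: (fun n => w n * x n) + (fun n => w n * y n))//.
by apply/funext => n; rewrite !fctE mulrDr -![a *: _]/(a * _) mulrCA.
Qed.

HB.instance Definition _ :=
  GRing.isSubmodClosed.Build R (int -> R) h1summable h1summable_submod_closed.

Record h1 := H1 {
  h1_val :> int -> R;
  h1_subproof : h1_val \in h1summable }.

HB.instance Definition _ := [isSub for h1_val].
HB.instance Definition _ := [Choice of h1 by <:].
HB.instance Definition _ := [SubChoice_isSubLmodule of h1 by <:].

Definition h1norm (x : h1) : R := Num.sqrt (h1dot x x).

Let to_l2 (x : h1) : l2 R := L2 (etrans (esym (h1_l2 x)) (h1_subproof x)).

Let of_l2_subproof (y : l2 R) : (fun n => (w n)^-1 * y n) \in h1summable.
Proof.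
rewrite h1_l2 (_ : (fun _ => _) = y); first exact: l2_subproof.
by apply/funext => n; rewrite mulVKf.
Qed.

Let of_l2 (y : l2 R) : h1 := H1 (of_l2_subproof y).

Let of_l2K : cancel of_l2 to_l2.
Proof. by move=> y; apply/val_inj/funext => n; rewrite /= mulVKf. Qed.

Let to_l2D (x y : h1) : to_l2 (x + y) = to_l2 x + to_l2 y.
Proof. by apply/val_inj/funext => n; rewrite /= mulrDr. Qed.

Let to_l2Z a (x : h1) : to_l2 (a *: x) = a *: to_l2 x.
Proof. by apply/val_inj/funext => n; exact: mulrCA. Qed.

Let to_l2_inj : injective to_l2.
Proof.
move=> x y /(congr1 (@l2_val R)) xy; apply/val_inj/funext => n.
by have /(mulfI (w_neq0 n)) := congr1 (@^~ n) xy.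
Qed.

Lemma h1P (x : h1) : zcvg (fun n => n%:~R ^+ 2 * x n ^+ 2).
Proof. by case: x => x /= /asboolP. Qed.

Lemma h1_sqsummable (x : h1) : zcvg (fun n => x n ^+ 2).
Proof.
apply: (@zcvg_le _ _ _ _ (@l2P _ (to_l2 x))) => n; rewrite sqr_ge0/= exprMn w2.
by rewrite ler_peMl ?sqr_ge0// lerDl sqr_ge0.
Qed.

Let h1normE (x : h1) : h1norm x = `|to_l2 x|.
Proof.
rewrite /h1norm -[RHS]/(Num.sqrt (dot _ _)) /h1dot /dot -zsumD.
- by congr Num.sqrt; apply: eq_zsum => n; rewrite /= [RHS]mulrACA -[w n * w n]/(w n ^+ 2) w2; ring.
- by apply: zcvg_dot; exact: h1_sqsummable.
- exact: h1P.
Qed.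

Fact ler_h1normD (x y : h1) : h1norm (x + y) <= h1norm x + h1norm y.
Proof. by rewrite !h1normE to_l2D ler_normD. Qed.

Fact h1normZ a (x : h1) : h1norm (a *: x) = `|a| * h1norm x.
Proof. by rewrite !h1normE to_l2Z normrZ. Qed.

Fact h1norm_eq0 (x : h1) : h1norm x = 0 -> x = 0.
Proof.
rewrite h1normE => /normr0_eq0 x0; apply: to_l2_inj; rewrite x0.
by rewrite -[in RHS](scale0r 0) to_l2Z scale0r.
Qed.

HB.instance Definition _ :=
  Lmodule_isNormed.Build R h1 ler_h1normD h1normZ h1norm_eq0.

Lemma h1_complete (F : set_system h1) : ProperFilter F -> cauchy F -> cvg F.
Proof.
move=> FF /cauchyP Fc.
have to_l2B x y : to_l2 (x - y) = to_l2 x - to_l2 y.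
  by rewrite to_l2D -scaleN1r to_l2Z scaleN1r.
have ballE x e z : ball x e z = ball (to_l2 x) e (to_l2 z).
  by rewrite -!ball_normE /= -to_l2B -h1normE.
have : cvg (to_l2 @ F).
  apply: cauchy_cvg; apply/cauchyP => e e0.
  have [x Fx] := Fc e e0; exists (to_l2 x).
  apply: (@filterS _ F _ (ball x e) _ _ Fx) => z.
  by rewrite ballE.
move=> /cvg_ex[y Fy]; apply/cvg_ex; exists (of_l2 y).
apply/cvg_ballP => e e0; move/cvg_ballP : Fy => /(_ e e0).
by apply: filterS => z; rewrite ballE of_l2K.
Qed.

HB.instance Definition _ := Uniform_isComplete.Build h1 h1_complete.

End H1.

Arguments h1 : clear implicits.

Section Multilinear.
Context {R : realType}.

Definition span (E : lmodType R) (S : set E) : set E :=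
  [set x | exists n (a : 'I_n -> R) (f : 'I_n -> E),
    (forall i, S (f i)) /\ x = \sum_i a i *: f i].

Definition is_basis (V : lmodType R) (U : set V) (s : seq V) : Prop :=
  (forall v, v \in s -> U v) /\
  (forall v, U v -> exists! a : 'rV[R]_(size s),
    v = \sum_(i < size s) a 0 i *: s`_i).

(* A family, indexed by k, of alternating k-linear forms on [V], the k-th of
   which is evaluated on the sequences of length k. *)
Definition alternating (V : lmodType R) (omega : seq V -> R) : Prop :=
  (forall s t a x y, omega (s ++ (a *: x + y) :: t) =
     a * omega (s ++ x :: t) + omega (s ++ y :: t)) /\
  (forall s t u x, omega (s ++ x :: t ++ x :: u) = 0).

(* The exterior algebra of [V] is realized in the dual of the space of
   families of alternating forms; v_1 /\ ... /\ v_k is evaluation at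
   (v_1, ..., v_k), and no identification occurs since alternating forms
   separate the points of the exterior powers. *)
Definition ext (V : lmodType R) : Type :=
  {omega : seq V -> R | alternating omega} -> R.

HB.instance Definition _ (V : lmodType R) := GRing.Lmodule.on (ext V).

Definition wedge (V : lmodType R) (s : seq V) : ext V :=
  fun omega => sval omega s.

Definition extpow (V : lmodType R) (k : nat) (U : set V) : set (ext V) :=
  span [set wedge s | s in [set s : seq V |
    size s = k /\ forall v, v \in s -> U v]].

(* The top exterior power of a finite-dimensional subspace [U]. *)
Definition extmax (V : lmodType R) (U : set V) : set (ext V) :=
  [set w | exists s, is_basis U s /\ extpow (size s) U w].

Definition bilinear_form (V W : lmodType R) (b : V -> W -> R) : Prop :=
  (forall a x y w, b (a *: x + y) w = a * b x w + b y w) /\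
  (forall a v x y, b v (a *: x + y) = a * b v x + b v y).

(* Likewise V (x) W is realized in the dual of the space of bilinear forms. *)
Definition tens (V W : lmodType R) : Type :=
  {b : V -> W -> R | bilinear_form b} -> R.

HB.instance Definition _ (V W : lmodType R) := GRing.Lmodule.on (tens V W).

Definition tensor (V W : lmodType R) (v : V) (w : W) : tens V W :=
  fun b => sval b v w.

Definition tensprod (V W : lmodType R) (A : set V) (B : set W) :
    set (tens V W) :=
  span [set t | exists v w, [/\ A v, B w & t = tensor v w]].

End Multilinear.

(* The fibre over [b] is a line in the fixed vector space [E], and
   [chart b phi] means that the functions [phi b'], read on the fibres, form a
   local trivialization on a neighbourhood of [b] in [base]. *)
Record line_bundle (R : realType) (B : topologicalType) (E : lmodType R) :=
  LineBundle {
    base : set B;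
    fibre : B -> set E;
    chart : B -> (B -> E -> R) -> Prop }.

Definition restriction (R : realType) (B : topologicalType) (E : lmodType R)
    (L : line_bundle B E) (A : set B) : line_bundle B E :=
  LineBundle (base L `&` A) (fibre L) (chart L).

(* An orientation of a fibre is represented by a nonzero vector [o b]; only its
   class up to positive factors matters, so that [o] need not be continuous. *)
Definition orientable (R : realType) (B : topologicalType) (E : lmodType R)
    (L : line_bundle B E) : Prop :=
  exists o : B -> E,
    (forall b, base L b -> fibre L b (o b) /\ o b <> 0) /\
    (forall b, base L b -> exists phi, chart L b phi /\
      \forall b' \near within (base L) (nbhs b),
        0 < phi b (o b) * phi b' (o b')).

Section DeterminantBundle.
Context {R : realType} (X Y : completeNormedModType R).
Implicit Types (D T : blin X Y).

Definition ker (V W : lmodType R) (f : V -> W) : set V := [set x | f x = 0].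

Definition is_complement N (Phi : {linear 'rV[R]_N -> Y}) T : Prop :=
  [/\ injective Phi,
      range T `&` range Phi = [set 0] &
      forall y, exists x z, y = T x + Phi z].

(* The range is automatically closed, [X] and [Y] being complete. *)
Definition fredholm T : Prop :=
  (exists s, is_basis (ker T) s) /\
  (exists N (Phi : {linear 'rV[R]_N -> Y}), is_complement Phi T).

Fact adjoint_subproof D (f : blin Y R^o) : f \o D \in @bounded_linear R X R^o.
Proof.
have [linf [M fM]] := blinP f; have [linD [M' DM]] := blinP D.
apply/asboolP; split=> [a x y|]; first by rewrite /= linD linf.
exists (Num.max M 0 * M') => x; rewrite -mulrA.
apply: le_trans (fM _) _; apply: (@le_trans _ _ (Num.max M 0 * `|D x|)).
  by rewrite ler_wpM2r// le_max lexx.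
by rewrite ler_wpM2l// le_max lexx orbT.
Qed.

Definition adjoint D (f : blin Y R^o) : blin X R^o :=
  Blin (adjoint_subproof D f).

Definition det_space : lmodType R := tens (ext (blin Y R^o)) (ext X).

Definition det_line D : set det_space :=
  tensprod (extmax (ker (adjoint D))) (extmax (ker D)).

Definition stab N (Phi : {linear 'rV[R]_N -> Y}) D : X * 'rV[R]_N -> Y :=
  fun p => D p.1 + Phi p.2.

(* The graph of the linear map from det D to the top exterior power of
   ker (D (+) Phi): both sides of its value on the generator
   (y_l /\ ... /\ y_1) (x) (x_1 /\ ... /\ x_k) are multiplied by [c]. The
   vectors zeta_{l+1}, ..., zeta_N are the [zs`_j] with l <= j < N. *)
Definition iota_graph N (Phi : {linear 'rV[R]_N -> Y}) D
    (u : det_space) (w : ext (X * 'rV[R]_N)%type) : Prop :=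
  exists (xs : seq X) (ys : seq (blin Y R^o)) (zs : seq 'rV[R]_N)
         (xi : nat -> X) (c : R),
    let k := size xs in
    let l := size ys in
    [/\ is_basis (ker D) xs,
        is_basis (ker (adjoint D)) ys,
        is_basis setT zs,
        (forall j, (l <= j < N)%N -> D (xi j) + Phi zs`_j = 0) &
        u = c *: tensor (wedge (rev ys)) (wedge xs) /\
        w = c *: ((-1) ^+ (k * l)
            * (\det (\matrix_(i < l, j < l) (ys`_j : blin Y R^o) (Phi zs`_i))
               / \det (\matrix_(i < N, j < N) zs`_i 0 j))
            *: wedge ([seq (x, 0) | x <- xs]
                      ++ [seq (xi j, zs`_j) | j <- iota l (N - l)]))].

(* The trivialization of the determinant bundle near [T] obtained from the
   isomorphism [Phi] onto a complement of the image of [T] and from a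
   continuous frame [v] of the kernel bundle of D (+) Phi. *)
Definition det_chart T (phi : blin X Y -> det_space -> R) : Prop :=
  exists N (Phi : {linear 'rV[R]_N -> Y}) (U : set (blin X Y))
         m (v : 'I_m -> blin X Y -> (X * 'rV[R]_N)%type),
    [/\ is_complement Phi T,
        open_nbhs T U,
        (forall i, {within U `&` fredholm, continuous (v i)}) &
        forall D, U D -> fredholm D ->
          [/\ range (stab Phi D) = setT,
              is_basis (ker (stab Phi D)) [seq v i D | i <- enum 'I_m] &
              forall u, det_line D u ->
                iota_graph Phi D u
                  (phi D u *: wedge [seq v i D | i <- enum 'I_m])]].

Definition det_bundle : line_bundle (blin X Y) det_space :=
  LineBundle fredholm det_line det_chart.

End DeterminantBundle.

Section SelfAdjoint.
Context {R : realType}.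

(* [T], as an unbounded operator on [l2] with the dense domain [h1], has the
   same graph as its adjoint: z lies in the domain of T^* and T^* z = w iff
   <T x, z> = <x, w> for all x in [h1]. *)
Definition selfadjoint (T : blin (h1 R) (l2 R)) : Prop :=
  forall z w : l2 R,
    (forall x : h1 R, dot (T x) z = dot x w) <->
    (exists z' : h1 R, h1_val z' = l2_val z /\ T z' = w).

Definition fredholm_s : set (blin (h1 R) (l2 R)) :=
  [set T | fredholm T /\ selfadjoint T].

End SelfAdjoint.

(* Main.v *)
(** Over the invertible operators det is the trivial line generated by
    1 (x) 1, so an orientation has a coordinate there, a nonzero real number
    whose sign is locally constant. This sign changes along A + t E at t = 0,
    where A x = (n x_n) has kernel and cokernel spanned by e_0 and E is the
    projection onto e_0. On the other hand, A + eps E and A - eps E are joined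
    by the following polygon of invertible self-adjoint operators, J and J'
    being (J x)_n = |2 n + 1| x_(-n-1) and (J' x)_n = |n| x_(-n):
      A + eps E,  2 A + 1,  J,  - (2 A + 1),  - A - eps E,  J' - eps E,
      A - eps E.
    The reflections n |-> - n - 1 and n |-> - n of the integers exchange
    positive and negative spectrum; their composite is a shift, which accounts
    for the spectral flow 1 of the loop. *)
From HB Require Import structures.
Require Import Defs.
From mathcomp Require Import all_boot all_order all_algebra.
From mathcomp Require Import all_classical all_reals.
From mathcomp Require Import topology normedtype sequences realfun.
From mathcomp Require Import zify ring lra.

Set Implicit Arguments.
Unset Strict Implicit.
Unset Printing Implicit Defensive.

Import Order.TTheory GRing.Theory Num.Theory.
Import numFieldNormedType.Exports.

Local Open Scope classical_set_scope.
Local Open Scope ring_scope.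

(** * Reindexing of series over the integers *)

Section Reindexing.
Context {R : realType}.
Implicit Types (u v : int -> R) (p : int -> int).

Lemma zcvg_abs u : zcvg (fun n => `|u n|) -> zcvg u.
Proof.
move=> cu; apply: (@eq_zcvg _ (fun n => (`|u n| + u n) + -1 * `|u n|)).
  by move=> n; ring.
apply: zcvgD; last exact: zcvgZ.
apply: (@zcvg_le _ _ (fun n => 2 * `|u n|)); last exact: zcvgZ.
move=> n; have := ler_norm (u n); have := ler_norm (- u n).
by rewrite normrN; lra.
Qed.

Lemma le_zsum u v : (forall n, 0 <= u n <= v n) -> zcvg v ->
  zsum u <= zsum v.
Proof.
move=> uv cv; have [|N|//] := @zsum_bounded _ u _ (zsum v).
  by move=> n; have /andP[] := uv n.
apply: (@le_trans _ _ (series (zfold v) N)); last first.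
  by apply: zsum_partial_le cv => n; have /andP[/le_trans h /h] := uv n.
rewrite !seriesEord; apply: ler_sum => i _.
by rewrite lerD//; [have /andP[] := uv (Posz i)|have /andP[] := uv (Negz i)].
Qed.

(** [zsum] is the limit of the sums over the intervals [- N, N - 1], which [p] need not preserve;
    absolute summability controls the discrepancy. *)
Definition reindexing p : Prop :=
  forall u, zcvg (fun n => `|u n|) -> zcvg (u \o p) /\ zsum (u \o p) = zsum u.

(** The reflection exchanges [Posz i] and [Negz i], so the folded sequence itself is unchanged. *)
Lemma reindexing_flip : reindexing (fun n => - n - 1).
Proof.
move=> u /zcvg_abs; rewrite /zcvg /zsum.
suff -> : zfold (u \o (fun n => - n - 1)) = zfold u by [].
apply/funext => i; rewrite /zfold /= addrC; congr (u _ + u _); lia.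
Qed.

Lemma reindexing_opp : reindexing -%R.
Proof.
move=> u cu.
(* Partial sums run over [-N, N - 1], which negation maps to [1 - N, N]. *)
have partial N : series (zfold (u \o -%R)) N =
    series (zfold u) N + (u (Posz N) - u (- Posz N)).
  elim: N => [|N ihN]; first by rewrite /series /= !big_geq// oppr0 subrr addr0.
  rewrite !seriesSr ihN /zfold /=.
  have -> : - Negz N = Posz N.+1 by [].
  have -> : - Posz N.+1 = Negz N by [].
  ring.
have cv0 : zfold (fun n => `|u n|) N @[N --> \oo] --> (0 : R).
  exact: cvg_series_cvg_0 cu.
have cv0N : - zfold (fun n => `|u n|) N @[N --> \oo] --> (0 : R).
  by rewrite -oppr0; exact: cvgN.
have cvP : u (Posz N) @[N --> \oo] --> (0 : R).
  apply: (squeeze_cvgr _ cv0N cv0); apply: nearW => N.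
  rewrite /zfold; have := ler_norm (u N); have := ler_norm (- u N).
  by have := normr_ge0 (u (Negz N)); rewrite normrN; lra.
have cvN : u (- Posz N) @[N --> \oo] --> (0 : R).
  (* After the shift the index is - (N + 1) = [Negz N], one of the two indices folded into the N-th
     term. *)
  rewrite -cvg_shiftS.
  apply: (squeeze_cvgr _ cv0N cv0); apply: nearW => N.
  change (- zfold (fun n => `|u n|) N <= u (Negz N) <=
    zfold (fun n => `|u n|) N).
  rewrite /zfold.
  have := ler_norm (u (Negz N)); have := ler_norm (- u (Negz N)).
  by have := normr_ge0 (u (Posz N)); rewrite normrN; lra.
have cv : series (zfold (u \o -%R)) N @[N --> \oo] --> zsum u.
  under eq_fun do rewrite partial.
  rewrite -[zsum u]addr0 -[X in _ + X](subrr (0 : R)).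
  apply: cvgD; first exact: zcvg_abs cu.
  exact: cvgB.
split; first by apply/cvg_ex; exists (zsum u).
exact: cvg_lim cv.
Qed.

End Reindexing.

(** * Operators that couple only the coordinates n and [p n] *)

Section CoefficientOperators.
Context {R : realType}.
Implicit Types (x y : h1 R) (a b : int -> R) (p : int -> int).

(** Comparable to the square root of 1 + n^2, the weight of the [h1] norm; coefficients of this
    order define bounded operators from [h1] to [l2]. *)
Definition weight (n : int) : R := 1 + `|n%:~R|.

Lemma weight_ge1 n : 1 <= weight n.
Proof. by rewrite /weight lerDl. Qed.

Lemma weight_sqr_le n : weight n ^+ 2 <= 2 * (1 + n%:~R ^+ 2).
Proof.
rewrite /weight -(real_normK (num_real n%:~R)).
by have := sqr_ge0 (1 - `|n%:~R : R|); lra.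
Qed.

Lemma h1_norm_sqr x :
  zcvg (fun n => (1 + n%:~R ^+ 2) * x n ^+ 2) /\
  zsum (fun n => (1 + n%:~R ^+ 2) * x n ^+ 2) = `|x| ^+ 2.
Proof.
have c1 := @h1_sqsummable _ x; have c2 := @h1P _ x.
have E : (fun n => (1 + n%:~R ^+ 2) * x n ^+ 2) =
    (fun n => x n ^+ 2 + n%:~R ^+ 2 * x n ^+ 2).
  by apply/funext => n; ring.
rewrite E; split; first exact: zcvgD.
rewrite zsumD// -[`|x|]/(Num.sqrt _) sqr_sqrtr.
  by rewrite /h1dot /dot; congr (_ + _); apply: eq_zsum => n; rewrite expr2.
apply: addr_ge0; apply: zsum_ge0 => [n|].
- by rewrite -expr2 sqr_ge0.
- exact: zcvg_dot.
- by rewrite -expr2 mulr_ge0 ?sqr_ge0.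
- by apply: eq_zcvg c2 => n; rewrite expr2.
Qed.

Lemma zcvg_weighted a C x : (forall n, `|a n| <= C * weight n) ->
  zcvg (fun n => (a n * x n) ^+ 2).
Proof.
move=> aC; have [c _] := h1_norm_sqr x.
apply: (@zcvg_le _ _ (fun n => (2 * C ^+ 2) *
  ((1 + n%:~R ^+ 2) * x n ^+ 2))); last exact: zcvgZ.
move=> n; rewrite sqr_ge0/=.
rewrite exprMn [leRHS]mulrA ler_wpM2r ?sqr_ge0//.
have : `|a n| ^+ 2 <= (C * weight n) ^+ 2.
  by rewrite ler_sqr ?nnegrE ?(le_trans _ (aC n)).
rewrite real_normK ?num_real// => h; apply: (le_trans h); rewrite exprMn.
by have := ler_wpM2l (sqr_ge0 C) (weight_sqr_le n); lra.
Qed.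

(** The weight bound, together with the reindexing of sums, makes composition with [p] bounded for
    the [h1] norm. *)
Record symmetry p : Prop := Symmetry {
  symmetry_involutive : involutive p;
  symmetry_reindexing : @reindexing R p;
  symmetry_weight : forall n, weight (p n) <= 2 * weight n }.

Lemma symmetry_opp : symmetry -%R.
Proof.
split; [exact: opprK|exact: reindexing_opp|move=> n].
by rewrite /weight mulrNz normrN; have := normr_ge0 (n%:~R : R); lra.
Qed.

Lemma symmetry_flip : symmetry (fun n => - n - 1).
Proof.
split; [by move=> n; ring|exact: reindexing_flip|move=> n].
rewrite /weight intrB mulrNz; have := ler_normB (- n%:~R : R) 1.
by rewrite normrN normr1; have := normr_ge0 (n%:~R : R); lra.
Qed.

Lemma zcvg_symmetry p (u : int -> R) : symmetry p ->
  (forall n, 0 <= u n) -> zcvg u -> zcvg (u \o p) /\ zsum (u \o p) = zsum u.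
Proof.
move=> sp u0 cu; apply: (symmetry_reindexing sp).
by apply: eq_zcvg cu => n; rewrite ger0_norm.
Qed.

Section Operator.
Variables (p : int -> int) (a b : int -> R) (C : R).
Hypothesis sp : symmetry p.
Hypothesis aC : forall n, `|a n| <= C * weight n.
Hypothesis bC : forall n, `|b n| <= C * weight n.

Let value x n := a n * x n + b n * x (p n).

Let value_bound x : zcvg (fun n => value x n ^+ 2) /\
  zsum (fun n => value x n ^+ 2) <= (5 * C) ^+ 2 * `|x| ^+ 2.
Proof.
have [c s] := h1_norm_sqr x.
set q := (fun n => (1 + n%:~R ^+ 2) * x n ^+ 2) in c s.
have q0 n : 0 <= q n by rewrite mulr_ge0 ?addr_ge0 ?sqr_ge0.
have [cp sq] := zcvg_symmetry sp q0 c.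
have coefC (e r : R) n : `|e| <= C * weight n -> (e * r) ^+ 2 <=
    C ^+ 2 * (weight n ^+ 2 * r ^+ 2).
  move=> eC; rewrite exprMn [leRHS]mulrA ler_wpM2r ?sqr_ge0//.
  rewrite -exprMn -(real_normK (num_real e)).
  by rewrite ler_sqr ?nnegrE// (le_trans _ eC).
(* This is (r + s)^2 <= 2 r^2 + 2 s^2 with the bounds 2 [q n] and 8 [q (p n)], the 8 coming from
   [weight n <= 2 * weight (p n)]. After summation the total 20 C^2 is rounded up to (5 C)^2. *)
have bnd n : 0 <= value x n ^+ 2 <=
    4 * C ^+ 2 * q n + 16 * C ^+ 2 * (q \o p) n.
  rewrite sqr_ge0/=.
  have h1 := coefC _ (x n) _ (aC n); have h2 := coefC _ (x (p n)) _ (bC n).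
  have w1 : weight n ^+ 2 * x n ^+ 2 <= 2 * q n.
    by rewrite /q [leRHS]mulrA ler_wpM2r ?sqr_ge0// weight_sqr_le.
  have w2 : weight n ^+ 2 * x (p n) ^+ 2 <= 8 * q (p n).
    rewrite /q [leRHS]mulrA ler_wpM2r ?sqr_ge0//.
    have := weight_sqr_le (p n).
    have : weight n ^+ 2 <= (2 * weight (p n)) ^+ 2.
      have w0 m : 0 <= weight m by apply: le_trans (weight_ge1 m).
      rewrite ler_sqr ?nnegrE ?mulr_ge0//.
      by rewrite -{1}(symmetry_involutive sp n) symmetry_weight.
    rewrite exprMn; lra.
  have := ler_wpM2l (sqr_ge0 C) w1; have := ler_wpM2l (sqr_ge0 C) w2.
  have := sqr_ge0 (a n * x n - b n * x (p n)).
  by rewrite /value /=; lra.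
have cR : zcvg (fun n => 4 * C ^+ 2 * q n + 16 * C ^+ 2 * (q \o p) n).
  by apply: zcvgD; exact: zcvgZ.
split; first exact: zcvg_le bnd cR.
apply: le_trans (le_zsum bnd cR) _.
rewrite zsumD; [|exact: zcvgZ..].
rewrite !zsumZ// sq s.
by have := mulr_ge0 (sqr_ge0 C) (sqr_ge0 `|x|); lra.
Qed.

Lemma coef_operator : exists D : blin (h1 R) (l2 R),
  forall x n, D x n = a n * x n + b n * x (p n).
Proof.
have vin x : value x \in @sqsummable R.
  by apply/asboolP; have [] := value_bound x.
pose T x : l2 R := L2 (vin x).
have Tin : T \in @bounded_linear R (h1 R) (l2 R).
  apply/asboolP; split.
    move=> r x y; apply/val_inj/funext => n.
    rewrite /= -[RHS]/(r * value x n + value y n) /value.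
    rewrite -[(r *: x + y) n]/(r * x n + y n).
    rewrite -[(r *: x + y) (p n)]/(r * x (p n) + y (p n)); ring.
  exists (`|5 * C|) => x; have [_ h] := value_bound x.
  rewrite -ler_sqr ?nnegrE ?mulr_ge0//.
  rewrite exprMn real_normK ?num_real//; apply: le_trans h.
  rewrite -[`|T x|]/(Num.sqrt _) sqr_sqrtr ?dot_ge0//.
by exists (Blin Tin).
Qed.

Variable D : blin (h1 R) (l2 R).
Hypothesis DE : forall x n, D x n = a n * x n + b n * x (p n).
Hypothesis bp : forall n, b (p n) = b n.

(** Substituting [p n] for n in the sum of the b n * x (p n) * y n moves [p] from [x] to [y],
    because [b] is invariant under the involution [p]. *)
Lemma coef_symmetric x y : dot (D x) y = dot x (D y).
Proof.
have [ax bx] := (zcvg_weighted aC (x := x), zcvg_weighted bC (x := x)).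
have cy := @h1_sqsummable _ y.
have [cyp _] := zcvg_symmetry sp (fun n => sqr_ge0 (y n)) cy.
have abs2 (u : int -> R) : zcvg (fun n => u n ^+ 2) ->
    zcvg (fun n => `|u n| ^+ 2).
  by apply: eq_zcvg => n; rewrite real_normK ?num_real.
pose v n := (b n * x n) * y (p n).
have cv : zcvg (fun n => `|v n|).
  apply: (@eq_zcvg _ (fun n => `|b n * x n| * `|y (p n)|)).
    by move=> n; rewrite -normrM.
  by apply: zcvg_dot; apply: abs2.
have [cvp sv] := symmetry_reindexing sp cv.
have axy := zcvg_dot ax cy.
transitivity (zsum (fun n => (a n * x n) * y n + (v \o p) n)).
  apply: eq_zsum => n; rewrite DE /v /= (symmetry_involutive sp) bp; ring.
rewrite zsumD// sv -zsumD//; last exact: zcvg_abs.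
apply: eq_zsum => n; rewrite DE /v; ring.
Qed.

Variable c : R.
Hypothesis c0 : 0 < c.
(* On the span of e_n and e_(p n), [D] is the symmetric matrix with diagonal
   (a n, a (p n)) and off-diagonal entry b n; if n = p n, the determinant below
   still bounds (a n + b n) away from 0, being divisible by it. *)
Hypothesis det_ge :
  forall n, c * weight n ^+ 2 <= `|a n * a (p n) - b n ^+ 2|.

Let det n := a n * a (p n) - b n ^+ 2.

Let wgt0 n : 0 < weight n.
Proof. by apply: lt_le_trans (weight_ge1 n). Qed.

Let det_neq0 n : det n != 0.
Proof.
rewrite -normr_gt0 (lt_le_trans _ (det_ge n))// mulr_gt0// exprn_gt0//.
Qed.

(** Elimination of [x (p n)] from the two equations at n and [p n] leaves [det n * x n = 0]. *)
Lemma coef_injective x : D x = 0 -> x = 0.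
Proof.
move=> Dx0; apply/val_inj/funext => n.
have e m : a m * x m + b m * x (p m) = 0 by rewrite -DE Dx0.
have := e n; have := e (p n); rewrite bp (symmetry_involutive sp) => e2 e1.
apply: (mulfI (det_neq0 n)); change (det n * x n = det n * 0); rewrite mulr0.
transitivity (a (p n) * (a n * x n + b n * x (p n)) -
  b n * (a (p n) * x (p n) + b n * x n)); first by rewrite /det; ring.
by rewrite e1 e2; ring.
Qed.

(** Cramer's rule on each block: the coefficients in the numerator are of order [weight n] and the
    determinant is at least of order [weight n ^+ 2], so the solution gains the factor that puts it
    in [h1]. *)
Lemma coef_surjective (y : l2 R) : exists x, D x = y.
Proof.
have C0 : 0 <= C.
  have := le_trans (normr_ge0 _) (aC 0).
  by rewrite pmulr_lge0.
pose z n := (det n)^-1 * (a (p n) * y n - b n * y (p n)).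
pose K := c^-1 * (2 * C).
have [cyp _] := zcvg_symmetry sp (fun n => sqr_ge0 (y n)) (@l2P _ y).
have zle n : `|n%:~R * z n| <= K * (`|y n| + `|y (p n)|).
  have num : `|a (p n) * y n - b n * y (p n)| <=
      2 * C * weight n * (`|y n| + `|y (p n)|).
    rewrite (le_trans (ler_normB _ _))// !normrM mulrDr lerD// ler_wpM2r//.
      apply: (le_trans (aC _)); have := symmetry_weight sp n.
      by move=> /(ler_wpM2l C0); lra.
    apply: (le_trans (bC _)).
    by have := mulr_ge0 C0 (ltW (wgt0 n)); lra.
  have nw : `|n%:~R| <= weight n by rewrite /weight lerDr.
  have dle : `|det n|^-1 <= c^-1 * (weight n)^-1 ^+ 2.
    rewrite exprVn -invfM lef_pV2 ?posrE ?mulr_gt0 ?exprn_gt0//.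
    by rewrite normr_gt0.
  rewrite normrM /z normrM normfV.
  have s0 : 0 <= `|y n| + `|y (p n)| by rewrite addr_ge0.
  apply: (@le_trans _ _ (weight n * (c^-1 * (weight n)^-1 ^+ 2 *
    (2 * C * weight n * (`|y n| + `|y (p n)|))))).
    apply: ler_pM => //; first by rewrite mulr_ge0 ?invr_ge0.
    by apply: ler_pM; rewrite ?invr_ge0.
  rewrite le_eqVlt; apply/orP; left; apply/eqP.
  rewrite /K; field.
  by rewrite !lt0r_neq0 ?wgt0.
have zin : z \in @h1summable R.
  apply/asboolP; apply: (@zcvg_le _ _ (fun n =>
      2 * K ^+ 2 * y n ^+ 2 + 2 * K ^+ 2 * y (p n) ^+ 2)).
    move=> n; rewrite -exprMn sqr_ge0/=.
    have : `|n%:~R * z n| ^+ 2 <= (K * (`|y n| + `|y (p n)|)) ^+ 2.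
      by rewrite ler_sqr ?nnegrE// (le_trans _ (zle n)).
    rewrite real_normK ?num_real// => h; apply: (le_trans h).
    rewrite exprMn -[in X in _ <= X](real_normK (num_real (y n))).
    rewrite -[in X in _ <= _ + X](real_normK (num_real (y (p n)))).
    have := mulr_ge0 (sqr_ge0 K) (sqr_ge0 (`|y n| - `|y (p n)|)); lra.
  by apply: zcvgD; apply: zcvgZ; [exact: l2P|exact: cyp].
exists (H1 zin); apply/val_inj/funext => n; rewrite /= DE /= /z.
have -> : det (p n) = det n.
  by rewrite /det (symmetry_involutive sp) bp; ring.
rewrite (symmetry_involutive sp) bp.
apply: (mulfI (det_neq0 n)).
transitivity (det n * (det n)^-1 * det n * y n).
  by rewrite [in RHS]/det; rewrite /det; ring.
by rewrite divff ?mul1r.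
Qed.

End Operator.
End CoefficientOperators.

(** * Bases and spans in dimensions zero and one *)

Section Bases.
Context {R : realType} {V : lmodType R}.
Implicit Types (U : set V) (s : seq V).

Lemma is_basis_nil U : U = [set 0] -> is_basis U [::].
Proof.
move=> ->; split=> // v /= ->; exists 0; split; first by rewrite big_ord0.
by move=> a _; apply/rowP => -[].
Qed.

(** A zero entry would give the vector 0 two coordinate rows, the zero row and a unit row. *)
Lemma is_basis_neq0 U s i : is_basis U s -> (i < size s)%N -> s`_i != 0.
Proof.
move=> [sU bU] lti; apply/eqP => si0.
have U0 : U 0 by rewrite -si0; apply: sU; exact: mem_nth.
have [a [_ a_unique]] := bU 0 U0.
have e0 : a = 0 by apply: a_unique; rewrite big1// => j _; rewrite mxE scale0r.
have : a = delta_mx 0 (Ordinal lti).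
  apply: a_unique; rewrite (bigD1 (Ordinal lti))//= si0 scaler0 add0r big1//.
  by move=> j /negPf jne; rewrite mxE jne andbF scale0r.
rewrite e0 => /matrixP/(_ 0 (Ordinal lti)) /eqP.
by rewrite !mxE !eqxx eq_sym oner_eq0.
Qed.

Lemma is_basis_trivial U s : U `<=` [set 0] -> is_basis U s -> s = [::].
Proof.
move=> U0 bs; case: s bs => [//|v s] bs.
have := @is_basis_neq0 _ _ 0 bs isT.
by rewrite (U0 v) ?eqxx//; apply: bs.1; rewrite mem_head.
Qed.

Lemma is_basis_size_gt0 U s v : U v -> v <> 0 -> is_basis U s ->
  (0 < size s)%N.
Proof.
move=> Uv v0 [_ /(_ v Uv) [a [va _]]]; case: s a va => [|//] a va.
by case: v0; rewrite va big_ord0.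
Qed.

Lemma span_line (S : set V) e v :
  (forall x, S x -> exists r : R, x = r *: e) ->
  Defs.span S v -> exists a : R, v = a *: e.
Proof.
move=> Se [n [a [f [Sf ->]]]].
have /choice[r rE] : forall i, exists r : R, f i = r *: e by move=> i; exact: Se.
exists (\sum_i a i * r i); rewrite scaler_suml; apply: eq_bigr => i _.
by rewrite rE scalerA.
Qed.

End Bases.

(** * Alternating forms that detect coefficients in degrees zero and one *)

Section AlternatingForms.
Context {R : realType}.
Implicit Types V W : lmodType R.

(** The form 1 in degree zero, extended by zero; it reads off the coefficient of [wedge [::]], the
    generator for the zero space. *)
Lemma nil_alternating V : alternating (fun s : seq V => (nilp s)%:R : R).
Proof.
split=> [s t a x y|s t u x]; first by case: s => [|? ?] /=; rewrite mulr0 addr0.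
by case: s.
Qed.

(** A linear form placed in degree one; it measures frames that consist of a single vector. *)
Lemma singleton_alternating V (f : V -> R) :
  (forall a x y, f (a *: x + y) = a * f x + f y) ->
  alternating (fun s => if s is [:: x] then f x else 0).
Proof.
move=> linf; split=> [[|z [|? s]] [|? t] a x y|[|? [|? s]] [|? t] u x] //=;
  by rewrite mulr0 addr0.
Qed.

Definition nil_form V : {omega : seq V -> R | alternating omega} :=
  exist _ _ (nil_alternating V).

Lemma eval_nil_bilinear V W :
  bilinear_form (fun (v : ext V) (w : ext W) =>
    v (nil_form V) * w (nil_form W)).
Proof.
split=> [a x y w|a v x y].
  rewrite -[(a *: x + y) _]/(a * x (nil_form V) + y (nil_form V)); ring.
rewrite -[(a *: x + y) _]/(a * x (nil_form W) + y (nil_form W)); ring.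
Qed.

Lemma tensorZ V W (a b : R) (v : V) (w : W) :
  tensor (a *: v) (b *: w) = (a * b) *: tensor v w.
Proof.
apply/funext => -[f bf]; rewrite /tensor /=; have [linl linr] := bf.
rewrite -[RHS]/((a * b) * f v w).
have f0l x : f 0 x = 0.
  by have := linl 1 0 0 x; rewrite scale1r addr0 mul1r; lra.
have f0r x : f x 0 = 0.
  by have := linr 1 x 0 0; rewrite scale1r addr0 mul1r; lra.
rewrite -[a *: v]addr0 linl -[b *: w]addr0 linr f0l f0r !addr0; ring.
Qed.

End AlternatingForms.

(** * The determinant line and its charts at invertible operators *)

Section ChartsAtIsomorphisms.
Context {R : realType} {X Y : completeNormedModType R}.
Implicit Types (D T : blin X Y).

Definition iso D : Prop :=
  (forall x, D x = 0 -> x = 0) /\ (forall y, exists x, D x = y).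

(** At an isomorphism the kernel and the cokernel vanish, and this is the coordinate relative to the
    generator [tensor (wedge [::]) (wedge [::])]. *)
Definition det_coord (u : @det_space R X Y) : R :=
  u (exist _ _ (eval_nil_bilinear (blin Y R^o) X)).

Lemma iso_fredholm D : iso D -> fredholm D.
Proof.
move=> [injD surjD]; split.
  exists [::]; apply: is_basis_nil; apply/seteqP; split=> x; first exact: injD.
  by move=> /= ->; exact: linear0.
exists 0%N, (\0 : {linear 'rV[R]_0 -> Y}); split.
- by move=> z z' _; rewrite [z]thinmx0 [z']thinmx0.
- apply/seteqP; split=> y; first by move=> [_ [z _ <-]].
  move=> /= ->; split; first by exists 0 => //; exact: linear0.
  by exists 0.
- by move=> y; have [x xy] := surjD y; exists x, 0; rewrite xy addr0.
Qed.

Lemma iso_ker D : iso D -> ker D `<=` [set 0].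
Proof. by move=> [injD _] x; exact: injD. Qed.

Lemma iso_ker_adjoint D : iso D -> ker (adjoint D) `<=` [set 0].
Proof.
move=> [_ surjD] f /= f0; apply/val_inj/funext => y.
by have [x <-] := surjD y; rewrite -[LHS]/(adjoint D f x) f0.
Qed.

Lemma extmax_trivial (V : lmodType R) (U : set V) w :
  U `<=` [set 0] -> extmax U w -> exists a : R, w = a *: wedge [::].
Proof.
move=> U0 [s [bs]]; rewrite (is_basis_trivial U0 bs); apply: span_line.
by move=> _ [t [/size0nil -> _] <-]; exists 1; rewrite scale1r.
Qed.

Lemma det_coordZ c :
  det_coord (c *: tensor (wedge [::]) (wedge [::])) = c.
Proof. by transitivity (c * (1 * 1)) => //; ring. Qed.

Lemma det_line_iso D u : iso D -> det_line D u ->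
  u = det_coord u *: tensor (wedge [::]) (wedge [::]).
Proof.
move=> isoD hu; suff [r ->] : exists r : R,
    u = r *: tensor (wedge [::]) (wedge [::]) by rewrite det_coordZ.
apply: span_line hu => _ [v [w [hv hw ->]]].
have [b ->] := extmax_trivial (iso_ker_adjoint isoD) hv.
have [c ->] := extmax_trivial (iso_ker isoD) hw.
by exists (b * c); exact: tensorZ.
Qed.

(** Here k = l = 0, so the sign and the determinant of the pairing are 1, and only the division by
    the determinant of [zs] remains. *)
Lemma iota_graph_iso N (Phi : {linear 'rV[R]_N -> Y}) D u w :
  iso D -> iota_graph Phi D u w ->
  exists (zs : seq 'rV[R]_N) (xi : nat -> X),
    is_basis setT zs /\
    w = (det_coord u / \det (\matrix_(i < N, j < N) zs`_i 0 j)) *: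
      wedge [seq (xi j, zs`_j) | j <- iota 0 N].
Proof.
move=> isoD [xs [ys [zs [xi [c /= [bx b_y bz _]]]]]].
move: bx => /(is_basis_trivial (iso_ker isoD)) ->.
move: b_y => /(is_basis_trivial (iso_ker_adjoint isoD)) -> [-> ->].
exists zs, xi; split=> //.
by rewrite /= det_coordZ subn0 scalerA det_mx00 expr0 !mul1r.
Qed.

Lemma complement_iso N (Phi : {linear 'rV[R]_N -> Y}) D :
  iso D -> is_complement Phi D -> N = 0%N.
Proof.
move=> [_ surjD] [injPhi disj _]; case: N Phi injPhi disj => [//|N] Phi inj disj.
have /inj : Phi (delta_mx 0 ord0) = Phi 0.
  rewrite linear0; apply: (_ : [set 0] _); rewrite -disj; split.
    by have [x <-] := surjD (Phi (delta_mx 0 ord0)); exists x.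
  by eexists.
move=> /matrixP/(_ 0 ord0)/eqP.
by rewrite !mxE !eqxx oner_eq0.
Qed.

End ChartsAtIsomorphisms.

(** * Continuity of operators, signs and small perturbations *)

Section Continuity.
Context {R : realType}.

Lemma blin_continuous (X Y : normedModType R) (T : blin X Y) : continuous T.
Proof.
move=> x; apply/cvgrPdist_lt => e e0.
have K0 : 0 < 1 + opnorm T by rewrite ltr_pwDl ?opnorm_ge0.
apply/nbhs_normP; exists (e / (1 + opnorm T)); first exact: divr_gt0.
move=> y /=; rewrite ltr_pdivlMr// => xy; rewrite -linearB.
apply: le_lt_trans (le_opnorm T (x - y)) _; apply: le_lt_trans xy.
by rewrite mulrC ler_wpM2l// lerDr.
Qed.

Lemma sgr_same (x y : R) : 0 < x * y -> Num.sg x = Num.sg y.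
Proof.
case: (ltgtP x 0) => [x0|x0|->]; last by rewrite mul0r ltxx.
  by rewrite nmulr_rgt0// => y0; rewrite !ltr0_sg.
by rewrite pmulr_rgt0// => y0; rewrite !gtr0_sg.
Qed.

Lemma near_opposite_steps (V : normedModType R) (D E : V) (P : set V) :
  nbhs D P -> exists2 t : R, 0 < t & P (D + t *: E) /\ P (D + - t *: E).
Proof.
move=> /nbhs_normP[e /= e0 eP].
have K0 : 0 < 1 + `|E| by rewrite ltr_pwDl.
have t0 : 0 < e / (1 + `|E|) / 2 by rewrite !divr_gt0.
exists (e / (1 + `|E|) / 2) => //.
have small : e / (1 + `|E|) / 2 * `|E| < e.
  rewrite -[ltRHS](divfK (lt0r_neq0 K0)); set q := _ / _ in t0 *.
  by have := mulr_ge0 (ltW t0) (normr_ge0 E); lra.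
by split; apply: eP; rewrite /= opprD addrA subrr sub0r normrN normrZ ?normrN
  gtr0_norm.
Qed.

End Continuity.

(** * The sign of an orientation along paths of invertible operators *)

Section Orientations.
Context {R : realType} {X Y : completeNormedModType R}.
Variables (A : set (blin X Y)) (o : blin X Y -> @det_space R X Y).
Hypothesis AF : A `<=` @fredholm R X Y.
Hypothesis oA : forall D, A D -> det_line D (o D) /\ o D <> 0.
Hypothesis o_chart : forall D, A D -> exists phi, det_chart D phi /\
  \forall D' \near within A (nbhs D), 0 < phi D (o D) * phi D' (o D').

Let c D := det_coord (o D).

Lemma orientation_coord_neq0 D : A D -> iso D -> c D != 0.
Proof.
move=> AD isoD; have [hD oD0] := oA AD; apply/eqP => c0; apply: oD0.
by rewrite (det_line_iso isoD hD) -/(c D) c0 scale0r.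
Qed.

(** At an isomorphism the chart has N = 0. Evaluating its graph on [nil_form] gives [c D'] as
    [phi D' (o D')] times a constant that is 0 or 1, and [c D != 0] rules out 0. *)
Lemma same_sign_near D : A D -> iso D ->
  \forall D' \near D, A D' -> iso D' -> 0 < c D * c D'.
Proof.
move=> AD isoD; have [phi [[N [Phi [U [m [v [compl [oU UD] _ main]]]]]] sgn]] :=
  o_chart AD.
have N0 := complement_iso isoD compl; subst N.
have coordE D' : U D' -> A D' -> iso D' -> phi D' (o D') * (m == 0%N)%:R = c D'.
  move=> UD' AD' isoD'; have [_ _ graph] := main D' UD' (AF AD').
  have [zs [xi [_ /(congr1 (fun w => w (nil_form _)))]]] :=
    iota_graph_iso isoD' (graph _ (oA AD').1).
  rewrite -[LHS]/(_ * _) -[RHS]/(_ * _) /= det_mx00 divr1 mulr1 -/(c D') => <-.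
  by rewrite /nilp size_map size_enum_ord.
near=> D' => AD' isoD'.
have UD' : U D' by near: D'; exact: open_nbhs_nbhs.
have pos : A D' -> 0 < phi D (o D) * phi D' (o D') by near: D'.
have := orientation_coord_neq0 AD isoD.
rewrite -(coordE D)// -(coordE D')//.
case: (m == 0%N); rewrite ?mulr0 ?eqxx// !mulr1 => _; exact: pos.
Unshelve. all: by end_near.
Qed.

(** The sign of [c] is locally constant along the segment, hence continuous; if it changed, the
    intermediate value theorem would give a point where it is 0. *)
Lemma same_sign_segment D0 D1 :
  (forall t, 0 <= t <= 1 ->
     A ((1 - t) *: D0 + t *: D1) /\ iso ((1 - t) *: D0 + t *: D1)) ->
  0 < c D0 * c D1.
Proof.
move=> seg; pose D t := (1 - t) *: D0 + t *: D1.
have D_0 : D 0 = D0 by rewrite /D subr0 scale1r scale0r addr0.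
have D_1 : D 1 = D1 by rewrite /D subrr scale1r scale0r add0r.
have c_neq0 t : 0 <= t <= 1 -> c (D t) != 0.
  by move=> /seg[? ?]; exact: orientation_coord_neq0.
pose f t := Num.sg (c (D t)).
have cf : {within `[0, 1], continuous f}.
  apply/subspace_continuousP => t /=; rewrite in_itv /= => t01.
  have [ADt isoDt] := seg t t01.
  apply: cvg_near_cst.
  have cvD : D s @[s --> t] --> D t.
    apply: cvgD; apply: cvgZr_tmp; last exact: cvg_id.
    by apply: cvgB; [exact: cvg_cst|exact: cvg_id].
  have : \forall s \near t, A (D s) -> iso (D s) -> 0 < c (D t) * c (D s).
    exact: cvD (same_sign_near ADt isoDt).
  rewrite /within /=; apply: filterS => s h; rewrite in_itv /= => s01.
  have [ADs isoDs] := seg s s01.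
  by apply/esym/sgr_same; exact: (h ADs isoDs).
rewrite ltNge; apply/negP => le0.
have [|t] := @IVT R f 0 1 0 ler01 cf.
  rewrite ge_min le_max !sgr_le0 !sgr_ge0 D_0 D_1.
  move: le0; case: (ltgtP (c D0) 0) => [c0|c0|->] //=.
    by rewrite nmulr_rle0.
  by rewrite pmulr_rle0// => ->.
rewrite in_itv /= => t01 /eqP; rewrite sgr_eq0.
by rewrite (negPf (c_neq0 t t01)).
Qed.

(** * The change of sign where a one-dimensional kernel is crossed *)

Section Crossing.
Variables (T E : blin X Y) (ell : blin Y R^o) (e : X).
Hypothesis kerT : forall x, T x = 0 -> exists r : R, x = r *: e.
Hypothesis rangeT : forall y, ell y = 0 <-> exists x, T x = y.
Hypothesis ellE : ell (E e) != 0.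
Hypothesis AT : A T.
Hypothesis isoT : forall t : R, t != 0 -> A (T + t *: E) /\ iso (T + t *: E).

Let ellT x : ell (T x) = 0.
Proof. by apply/rangeT; exists x. Qed.

(** The kernel of [ell] is the image of [T], so [ell \o Phi] is an injective linear form and N <= 1;
    N = 0 would put [E e] into the image of [T]. *)
Lemma complement_rank1 N (Phi : {linear 'rV[R]_N -> Y}) :
  is_complement Phi T ->
  N = 1%N /\ forall z, ell (Phi z) = 0 -> z = 0.
Proof.
move=> [injPhi disj surj].
have inj z : ell (Phi z) = 0 -> z = 0.
  move=> /rangeT[x xz]; apply: injPhi; rewrite linear0.
  by apply: (_ : [set 0] _); rewrite -disj; split; [exists x|exists z].
split=> //; case: N Phi injPhi disj surj inj => [|[//|N]] Phi injPhi disj surj inj.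
  have [x [z xz]] := surj (E e).
  move: ellE; rewrite xz [z](_ : _ = 0); last by apply/rowP => -[].
  by rewrite linear0 addr0 ellT eqxx.
pose d i : 'rV[R]_N.+2 := delta_mx 0 i.
pose i1 : 'I_N.+2 := lift ord0 ord0.
(* A combination of two unit vectors that [ell \o Phi] kills; its entry at 0 then shows that [d i1]
   alone is killed. *)
have /matrixP comb : ell (Phi (d i1)) *: d ord0 - ell (Phi (d ord0)) *: d i1 = 0.
  have ellZ a z : ell (Phi (a *: z)) = a * ell (Phi z) by rewrite !linearZ.
  by apply: inj; rewrite !linearB /= !ellZ mulrC subrr.
have /inj /matrixP/(_ 0 i1)/eqP : ell (Phi (d i1)) = 0.
  by have := comb 0 ord0; rewrite !mxE !eqxx /= mulr1 mulr0 subr0.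
by rewrite !mxE !eqxx oner_eq0.
Qed.

(* With (x, z) the frame of ker (D (+) Phi) near [T], the chart divides the
   coordinate of det D by z; for D = T + t E the equation
   t ell (E x) + z ell (Phi 1) = 0 forces z to change sign with t. *)
Lemma opposite_sign_crossing :
  exists2 t : R, 0 < t & c (T + t *: E) * c (T + - t *: E) < 0.
Proof.
have [phi [[N [Phi [U [m [v [compl oU cont main]]]]]] sgn]] := o_chart AT.
have [N1 injPhi] := complement_rank1 compl; subst N.
have nU : nbhs T U by exact: open_nbhs_nbhs.
have UT : U T by case: oU.
pose k := ell (Phi (const_mx 1)).
have ellPhi z : ell (Phi z) = z 0 0 * k.
  rewrite [z](_ : _ = z 0 0 *: const_mx 1); last first.
    by apply/rowP => i; rewrite !mxE mulr1 ord1.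
  by rewrite !linearZ /= !mxE mulr1.
have k0 : k != 0.
  apply/eqP => /injPhi/matrixP/(_ 0 0)/eqP.
  by rewrite !mxE oner_eq0.
pose second (p : X * 'rV[R]_1) := p.2 0 0.
have second_linear a p q : second (a *: p + q) = a * second p + second q.
  by rewrite /second !mxE.
pose second_form : {omega | alternating omega} :=
  exist _ _ (singleton_alternating second_linear).
have coordE D : U D -> A D -> iso D ->
    phi D (o D) * sval second_form [seq v i D | i <- enum 'I_m] = c D.
  move=> UD AD isoD; have [_ _ graph] := main D UD (AF AD).
  have [zs [xi [bzs /(congr1 (fun w => w second_form))]]] :=
    iota_graph_iso isoD (graph _ (oA AD).1).
  rewrite -[LHS]/(_ * _) -[RHS]/(_ * _) => ->.
  have zs0 : zs`_0 0 0 != 0.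
    have szs : (0 < size zs)%N.
      apply: (@is_basis_size_gt0 _ _ setT zs (const_mx 1)) => //.
      by move=> /matrixP/(_ 0 0)/eqP; rewrite !mxE oner_eq0.
    have := is_basis_neq0 bzs szs; apply: contra_neq => z0.
    by apply/rowP => i; rewrite ord1 z0 mxE.
  by rewrite /= /second det_mx11 !mxE /= divfK.
(* [second_form] vanishes on frames of any other length, whereas [c] is nonzero at the isomorphisms
   [T + t *: E] close to [T]. *)
have m1 : m = 1%N.
  have [t t0 [Ut _]] := near_opposite_steps E nU.
  have [At isot] := isoT (lt0r_neq0 t0).
  have := orientation_coord_neq0 At isot; rewrite -coordE//=.
  have := size_enum_ord m; case: (enum 'I_m) => [|i [|j s]] //=.
    by move=> _; rewrite mulr0 eqxx.
  by move=> _; rewrite mulr0 eqxx.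
subst m.
have frameE D : [seq v i D | i <- enum 'I_1] = [:: v ord0 D].
  rewrite enum_ordSl /= (_ : enum 'I_0 = [::])//.
  by apply: size0nil; rewrite size_enum_ord.
pose w := v ord0; pose g x : R := ell (E x).
(* At [T] itself, applying [ell] kills the second component, so the frame vector is (r e, 0) with r
   nonzero. *)
have gT : g (w T).1 != 0.
  have [_ bT _] := main T UT (AF AT); rewrite frameE in bT.
  have wT0 : w T != 0 by exact: (@is_basis_neq0 _ _ _ _ 0%N bT).
  have : stab Phi T (w T) = 0 by apply: bT.1; rewrite mem_head.
  rewrite /stab => hw.
  have z0 : (w T).2 = 0.
    by apply: injPhi; have := congr1 ell hw; rewrite linearD /= ellT add0r linear0.
  move: hw; rewrite z0 linear0 addr0 => /kerT[r wr].
  rewrite /g wr !linearZ /= mulf_neq0//; apply: contra_neq wT0 => r0.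
  by rewrite [w T]surjective_pairing z0 wr r0 scale0r.
have g_near : \forall D \near T, A D -> U D -> 0 < g (w T).1 * g (w D).1.
  have /subspace_continuousP/(_ T (conj UT (AF AT))) cw := cont ord0.
  have cg : g (w D).1 @[D --> within (U `&` @fredholm R X Y) (nbhs T)] --> g (w T).1.
    have cw1 : (w D).1 @[D --> within (U `&` @fredholm R X Y) (nbhs T)] -->
        (w T).1.
      by apply: (@cvg_comp _ _ _ w fst _ _ _ cw); exact: cvg_fst.
    have cgx : {for (w T).1, continuous g}.
      by apply: continuous_comp; exact: blin_continuous.
    exact: (cvg_comp _ _ cw1 cgx).
  have cgg : g (w T).1 * g (w D).1 @[D --> within (U `&` @fredholm R X Y)
      (nbhs T)] --> g (w T).1 * g (w T).1.
    by apply: cvgM => //; exact: cvg_cst.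
  have pos : 0 < g (w T).1 * g (w T).1 by rewrite -expr2 exprn_even_gt0.
  have gt0 : nbhs T (fun D => (U `&` @fredholm R X Y) D ->
      0 < g (w T).1 * g (w D).1) by exact: cvgr_gt cgg _ pos.
  by apply: filterS gt0 => D h AD UD; apply: h; split => //; exact: AF.
have nearT : \forall D \near T, A D -> [/\ U D,
    0 < g (w T).1 * g (w D).1 & 0 < phi T (o T) * phi D (o D)].
  near=> D => AD.
  have UD : U D by near: D.
  split=> //.
    have : A D -> U D -> 0 < g (w T).1 * g (w D).1 by near: D.
    exact.
  have : A D -> 0 < phi T (o T) * phi D (o D) by near: D.
  exact.
have [t t0 [Pt Pnt]] := near_opposite_steps E nearT.
exists t => //.
have t_neq0 : t != 0 by exact: lt0r_neq0.
have nt_neq0 : - t != 0 by rewrite oppr_eq0.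
have formula s : s != 0 -> U (T + s *: E) ->
    c (T + s *: E) * k =
    - s * (phi (T + s *: E) (o (T + s *: E)) * g (w (T + s *: E)).1).
  move=> s0 Us; have [As isos] := isoT s0.
  rewrite -coordE// frameE /= /second -/w.
  have [_ bs _] := main _ Us (AF As); rewrite frameE in bs.
  have : stab Phi (T + s *: E) (w (T + s *: E)) = 0.
    by apply: bs.1; rewrite mem_head.
  rewrite /stab -[(T + s *: E) _]/(T _ + s *: E _) => /(congr1 ell).
  rewrite !linearD linearZ /= ellT ellPhi linear0 add0r.
  rewrite -[s *: ell _]/(s * g _) => /eqP; rewrite addrC addr_eq0 => /eqP hs.
  by rewrite -mulrA hs; ring.
have [At _] := isoT t_neq0; have [Ant _] := isoT nt_neq0.
have [Ut gt pt] := Pt At; have [Unt gnt pnt] := Pnt Ant.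
have ft := formula t t_neq0 Ut; have fnt := formula _ nt_neq0 Unt.
set cp := c _ in ft *; set cn := c _ in fnt *.
set pp := phi _ _ in ft pt; set pn := phi _ _ in fnt pnt.
set gp := g _ in ft gt; set gn := g _ in fnt gnt.
have k2 : 0 < k ^+ 2 by rewrite exprn_even_gt0.
(* The sign of [k] is unknown. The factor [k ^+ 2] lets [formula] be applied at t and at - t, whose
   prefactors - t and t multiply to - t^2. *)
rewrite -(pmulr_llt0 _ k2).
have -> : cp * cn * k ^+ 2 = - (t ^+ 2 * ((pp * pn) * (gp * gn))).
  transitivity ((cp * k) * (cn * k)); first by ring.
  by rewrite ft fnt; ring.
have same_sign (r a b : R) : 0 < r * a -> 0 < r * b -> 0 < a * b.
  move=> ra rb; have r0 : r != 0 by apply: contraTneq ra => ->; rewrite mul0r ltxx.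
  have r2 : 0 < r ^+ 2 by rewrite exprn_even_gt0.
  rewrite -(pmulr_rgt0 _ r2).
  have -> : r ^+ 2 * (a * b) = (r * a) * (r * b) by ring.
  exact: mulr_gt0.
rewrite oppr_lt0; apply: mulr_gt0; first by rewrite exprn_gt0.
by apply: mulr_gt0; [exact: same_sign pt pnt|exact: same_sign gt gnt].
Unshelve. all: by end_near.
Qed.

End Crossing.
End Orientations.

Lemma blin_combE (R : realType) (X Y : normedModType R) (S T : blin X Y)
  (r s : R) x : (r *: S + s *: T) x = r *: S x + s *: T x.
Proof. by []. Qed.

Lemma l2_combE (R : realType) (y z : l2 R) (r s : R) n :
  (r *: y + s *: z) n = r * y n + s * z n.
Proof. by []. Qed.

(** * Fredholm operators with one-dimensional kernel and cokernel *)

Section LineMap.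
Context {R : realType} {V : lmodType R}.

Definition line_map (v : V) : 'rV[R]_1 -> V := fun z => z 0 0 *: v.

Fact line_map_linear v : linear (line_map v).
Proof. by move=> a x y; rewrite /line_map !mxE scalerDl scalerA. Qed.

HB.instance Definition _ (v : V) :=
  GRing.isLinear.Build R 'rV[R]_1 V *:%R (line_map v) (line_map_linear v).

End LineMap.

(** The line of [f] is a complement of the image: [ell] is injective on it, and subtracting
    [ell y / ell f] times [f] brings [y] into the kernel of [ell]. *)
Lemma rank1_fredholm (R : realType) (X Y : completeNormedModType R)
    (T : blin X Y) (ell : blin Y R^o) (e : X) (f : Y) :
  e != 0 -> (forall x, T x = 0 <-> exists r : R, x = r *: e) ->
  (forall y, ell y = 0 <-> exists x, T x = y) -> ell f != 0 -> fredholm T.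
Proof.
move=> e0 kerT rangeT lf0; have ellT x : ell (T x) = 0 by apply/rangeT; exists x.
split.
  exists [:: e]; split=> [v|v].
    by rewrite inE => /eqP ->; apply/kerT; exists 1; rewrite scale1r.
  move=> /kerT[r ->]; exists (const_mx r); split.
    by rewrite big_ord_recl big_ord0 addr0 mxE /=.
  move=> a; rewrite big_ord_recl big_ord0 addr0 /= => /eqP.
  rewrite -subr_eq0 -scalerBl scaler_eq0 (negPf e0) orbF subr_eq0 => /eqP ->.
  by apply/rowP => i; rewrite !mxE; congr (a _ _); exact: esym (ord1 i).
exists 1%N, (line_map f : {linear 'rV[R]_1 -> Y}).
have ell_line z : ell (line_map f z) = z 0 0 * ell f by rewrite linearZ.
have inj z : ell (line_map f z) = 0 -> z = 0.
  rewrite ell_line => /eqP; rewrite mulf_eq0 (negPf lf0) orbF => /eqP z0.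
  by apply/rowP => i; rewrite ord1 z0 mxE.
split.
- move=> z z' /= zz'; apply/eqP; rewrite -subr_eq0; apply/eqP/inj.
  by rewrite linearB /= zz' subrr linear0.
- apply/seteqP; split=> y.
    by move=> [[x _ <-] [z _ zx]] /=; rewrite -zx (inj z) ?linear0// zx ellT.
  by move=> /= ->; split; exists 0 => //; exact: linear0.
- move=> y; pose z : 'rV[R]_1 := const_mx (ell y / ell f).
  have /rangeT[x xE] : ell (y - line_map f z) = 0.
    by rewrite linearB /= ell_line mxE divfK// subrr.
  by exists x, z; rewrite xE subrK.
Qed.

(** * Self-adjointness and the operators of the loop *)

Section SelfAdjointOperators.
Context {R : realType}.
Implicit Types (D : blin (h1 R) (l2 R)).

Definition h1_incl (x : h1 R) : l2 R :=
  L2 (introT (asboolP _) (@h1_sqsummable _ x)).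

(** If z and w satisfy the adjoint relation, w is orthogonal to the kernel, so w = D y. Then z - y
    is orthogonal to the image, hence a kernel element in [h1], and z itself lies in [h1]. *)
Lemma symmetric_selfadjoint D :
  (forall x y : h1 R, dot (D x) y = dot x (D y)) ->
  (forall w : l2 R, (forall x, D x = 0 -> dot x w = 0) -> exists x, D x = w) ->
  (forall z : l2 R, (forall x, dot (D x) z = 0) ->
     exists x, h1_incl x = z /\ D x = 0) ->
  selfadjoint D.
Proof.
move=> sym ran coran z w; split=> [zw|[z' [z'z <-]] x]; last first.
  by rewrite -z'z sym.
have dot0l (u : int -> R) : dot (0 : l2 R) u = 0.
  transitivity (dot (0 : l2 R) (0 : l2 R)).
    apply: eq_zsum => n.
    by rewrite -[(0 : l2 R) n]/(0 : R) !mul0r.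
  by rewrite -(scale0r (0 : l2 R)) dotZl mul0r.
have [x Dx0|y yw] := ran w; first by rewrite -zw Dx0 dot0l.
have [x|k [kz Dk]] := coran (z + -1 *: h1_incl y).
  by rewrite dotDr dotZr zw -yw sym mulN1r subrr.
exists (y + k); rewrite linearD /= yw Dk addr0; split=> //.
apply/funext => n; have /(congr1 (fun u : l2 R => u n)) := kz.
rewrite -[LHS]/(k n) -[RHS]/(z n + -1 * y n) => kn.
by change (y n + k n = z n); rewrite kn; ring.
Qed.

Lemma iso_fredholm_s D :
  (forall x y : h1 R, dot (D x) y = dot x (D y)) -> iso D -> fredholm_s D.
Proof.
move=> sym isoD; have [_ surjD] := isoD.
split; first exact: iso_fredholm.
apply: symmetric_selfadjoint => // z z0; exists 0; rewrite linear0; split=> //.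
have -> : z = 0 by apply: dot_eq0; have [x xz] := surjD z; rewrite -{1}xz z0.
exact/val_inj/funext.
Qed.

Lemma coef_good p a b C c D : @symmetry R p ->
  (forall n, `|a n| <= C * weight n) -> (forall n, `|b n| <= C * weight n) ->
  (forall x n, D x n = a n * x n + b n * x (p n)) -> (forall n, b (p n) = b n) ->
  0 < c -> (forall n, c * weight n ^+ 2 <= `|a n * a (p n) - b n ^+ 2|) ->
  fredholm_s D /\ iso D.
Proof.
move=> sp aC bC DE bp c0 hdet.
have isoD : iso D.
  split; first by move=> x; exact: (coef_injective sp DE bp c0 hdet).
  exact: (coef_surjective sp aC bC DE bp c0 hdet).
split=> //; apply: iso_fredholm_s => // x y.
exact: (coef_symmetric sp aC bC DE bp).
Qed.

(** * Diagonal operators combined with the reflection n to - n *)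

Section OppFamily.
Variables alpha beta gamma delta : R.

Let a (n : int) : R := alpha * n%:~R + gamma + delta * (n == 0)%:R.
Let b (n : int) : R := beta * `|n%:~R|.
Let C : R := `|alpha| + `|beta| + `|gamma| + `|delta|.

Let a_le n : `|a n| <= C * weight n.
Proof.
have d01 : `|(n == 0)%:R : R| <= 1 by case: (n == 0); rewrite ?normr1 ?normr0.
apply: le_trans (ler_normD _ _) _; rewrite normrM.
apply: le_trans (lerD (ler_normD _ _) (ler_piMr (normr_ge0 delta) d01)) _.
rewrite normrM /C /weight.
have := mulr_ge0 (normr_ge0 beta) (normr_ge0 (n%:~R : R)).
have := mulr_ge0 (normr_ge0 gamma) (normr_ge0 (n%:~R : R)).
have := mulr_ge0 (normr_ge0 delta) (normr_ge0 (n%:~R : R)).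
by have := normr_ge0 alpha; have := normr_ge0 beta; lra.
Qed.

Let b_le n : `|b n| <= C * weight n.
Proof.
rewrite normrM normr_id /C /weight.
have := mulr_ge0 (normr_ge0 alpha) (normr_ge0 (n%:~R : R)).
have := mulr_ge0 (normr_ge0 gamma) (normr_ge0 (n%:~R : R)).
have := mulr_ge0 (normr_ge0 delta) (normr_ge0 (n%:~R : R)).
have := normr_ge0 alpha; have := normr_ge0 beta; have := normr_ge0 gamma.
by have := normr_ge0 delta; lra.
Qed.

Let b_opp n : b (- n) = b n.
Proof. by rewrite /b mulrNz normrN. Qed.

Lemma opp_operator : exists D, forall x n,
  D x n = (alpha * n%:~R + gamma + delta * (n == 0)%:R) * x n +
    beta * `|n%:~R| * x (- n).
Proof. exact: (coef_operator symmetry_opp a_le b_le). Qed.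

Variable D : blin (h1 R) (l2 R).
Hypothesis DE : forall x n,
  D x n = (alpha * n%:~R + gamma + delta * (n == 0)%:R) * x n +
    beta * `|n%:~R| * x (- n).

Lemma opp_symmetric (x y : h1 R) : dot (D x) y = dot x (D y).
Proof. exact: (coef_symmetric symmetry_opp a_le b_le DE b_opp). Qed.

(** The first condition handles the coordinate 0, where the operator is multiplication by
    [gamma + delta]. The second handles n <> 0, where the block has determinant gamma^2 - (alpha^2 +
    beta^2) n^2 and |n| >= 1. *)
Lemma opp_iso : gamma + delta != 0 -> gamma ^+ 2 < alpha ^+ 2 + beta ^+ 2 ->
  fredholm_s D /\ iso D.
Proof.
move=> gd0 lt_gab; pose kappa := alpha ^+ 2 + beta ^+ 2 - gamma ^+ 2.
have kappa0 : 0 < kappa by rewrite subr_gt0.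
have gd2 : 0 < (gamma + delta) ^+ 2 by rewrite exprn_even_gt0.
(* The divisor 4 comes from [weight n] <= 2 |n| for n <> 0; the other entry is the exact determinant
   at 0, where the weight is 1. *)
pose c := Num.min (kappa / 4) ((gamma + delta) ^+ 2).
have c0 : 0 < c by rewrite lt_min gd2 divr_gt0.
apply: (coef_good symmetry_opp a_le b_le DE b_opp c0) => n.
have [->|n0] := eqVneq n 0.
  rewrite oppr0 /weight /a /b mulr0z normr0 !mulr0 addr0 expr1n add0r mulr1.
  rewrite expr0n subr0 -expr2 (ger0_norm (sqr_ge0 _)) mulr1 /c.
  by rewrite ge_min lexx orbT.
rewrite /a /b oppr_eq0 (negPf n0) !mulr0 !addr0 mulrNz.
have n1 : 1 <= `|n%:~R : R| by rewrite -intr_norm ler1z; lia.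
have nn : n%:~R * n%:~R = `|n%:~R : R| ^+ 2 by rewrite real_normK ?num_real.
have -> : (alpha * n%:~R + gamma) * (alpha * - n%:~R + gamma) -
    (beta * `|n%:~R|) ^+ 2 =
    - ((alpha ^+ 2 + beta ^+ 2) * `|n%:~R| ^+ 2 - gamma ^+ 2).
  by rewrite -nn exprMn -nn; ring.
rewrite normrN; apply: le_trans (ler_norm _).
rewrite /weight; set m := `|_| in n1 *.
have n2 : 1 <= m ^+ 2 by rewrite exprn_ege1.
apply: (@le_trans _ _ (kappa / 4 * (1 + m) ^+ 2)).
  by rewrite ler_wpM2r ?sqr_ge0// /c ge_min lexx.
have m4 : (1 + m) ^+ 2 <= 4 * m ^+ 2 by nra.
have := ler_wpM2l (ltW kappa0) m4; have := ler_wpM2l (sqr_ge0 gamma) n2.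
by rewrite /kappa; lra.
Qed.

End OppFamily.

(** * Diagonal operators combined with the reflection n to - n - 1 *)

Section FlipFamily.
Variables alpha beta : R.

Let a (n : int) : R := alpha * (2 * n%:~R + 1).
Let b (n : int) : R := beta * `|2 * n%:~R + 1|.
Let C : R := 2 * (`|alpha| + `|beta|).

Let odd_le (n : int) : `|2 * n%:~R + 1 : R| <= 2 * weight n.
Proof.
apply: le_trans (ler_normD _ _) _; rewrite normrM normr1 (ger0_norm (ler0n _ 2)).
by rewrite /weight; have := normr_ge0 (n%:~R : R); lra.
Qed.

Let a_le n : `|a n| <= C * weight n.
Proof.
rewrite normrM /C; have := ler_wpM2l (normr_ge0 alpha) (odd_le n).
have := mulr_ge0 (normr_ge0 beta) (le_trans ler01 (@weight_ge1 R n)); lra.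
Qed.

Let b_le n : `|b n| <= C * weight n.
Proof.
rewrite normrM normr_id /C; have := ler_wpM2l (normr_ge0 beta) (odd_le n).
have := mulr_ge0 (normr_ge0 alpha) (le_trans ler01 (@weight_ge1 R n)); lra.
Qed.

Let odd_flip (n : int) : 2 * (- n - 1)%:~R + 1 = - (2 * n%:~R + 1) :> R.
Proof. by rewrite intrB mulrNz; ring. Qed.

Let b_flip n : b (- n - 1) = b n.
Proof. by rewrite /b odd_flip normrN. Qed.

Lemma flip_operator : exists D, forall x n,
  D x n = alpha * (2 * n%:~R + 1) * x n +
    beta * `|2 * n%:~R + 1| * x (- n - 1).
Proof. exact: (coef_operator symmetry_flip a_le b_le). Qed.

(** The reflection negates 2 n + 1, so the diagonal and off-diagonal parts anticommute and the block
    determinant is - (alpha^2 + beta^2) (2 n + 1)^2. It never vanishes, 2 n + 1 being odd. *)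
Lemma flip_iso D :
  (forall x n, D x n = alpha * (2 * n%:~R + 1) * x n +
    beta * `|2 * n%:~R + 1| * x (- n - 1)) ->
  0 < alpha ^+ 2 + beta ^+ 2 -> fredholm_s D /\ iso D.
Proof.
move=> DE ab0.
have c0 : 0 < (alpha ^+ 2 + beta ^+ 2) / 4 by rewrite divr_gt0.
apply: (coef_good symmetry_flip a_le b_le DE b_flip c0) => n.
rewrite /a /b odd_flip exprMn real_normK ?num_real//.
have -> : alpha * (2 * n%:~R + 1) * (alpha * - (2 * n%:~R + 1)) -
    beta ^+ 2 * (2 * n%:~R + 1) ^+ 2 =
    - ((alpha ^+ 2 + beta ^+ 2) * (2 * n%:~R + 1) ^+ 2) by ring.
rewrite normrN; apply: le_trans (ler_norm _).
have w2 : weight n <= 2 * `|2 * n%:~R + 1 : R|.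
  have : (1 + `|n|)%:~R <= (2 * `|2 * n + 1|)%:~R :> R.
    by rewrite ler_int; lia.
  by rewrite !rmorphD !rmorphM /= !intr_norm !rmorphD !rmorphM /=.
have : weight n ^+ 2 <= (2 * `|2 * n%:~R + 1 : R|) ^+ 2.
  by rewrite ler_sqr ?nnegrE ?(le_trans ler01 (@weight_ge1 R n))// mulr_ge0.
rewrite exprMn real_normK ?num_real// => w4.
by have := ler_wpM2l (ltW ab0) w4; lra.
Qed.

End FlipFamily.

Fact delta0_h1summable : (fun n : int => (n == 0)%:R) \in @h1summable R.
Proof.
apply/asboolP; apply: eq_zcvg (@h1P _ (0 : h1 R)) => n.
rewrite -[(0 : h1 R) n]/(0 : R) expr0n mulr0.
by have [->|_] := eqVneq n 0; rewrite ?mulr0z expr0n ?mul0r ?mulr0.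
Qed.

Definition delta0 : h1 R := H1 delta0_h1summable.

Fact coord0_bounded_linear :
  (fun y : l2 R => y 0) \in @bounded_linear R (l2 R) R^o.
Proof.
apply/asboolP; split=> [a x y //|].
by exists 1 => y; rewrite mul1r; exact: l2_coord_le.
Qed.

Definition coord0 : blin (l2 R) R^o := Blin coord0_bounded_linear.

(** * The operator A at which the kernel is crossed *)

Section Crossing.
Variable A : blin (h1 R) (l2 R).
Hypothesis AE : forall x n, A x n = n%:~R * x n.

Lemma diag_ker x : A x = 0 <-> exists r : R, x = r *: delta0.
Proof.
split=> [Ax0|[r ->]]; last first.
  apply/val_inj/funext => n; rewrite /= AE.
  rewrite -[(r *: delta0) n]/(r * (n == 0)%:R) -[RHS]/(0 : R).
  by have [->|_] := eqVneq n 0; rewrite ?mulr0z ?mul0r// !mulr0.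
exists (x 0); apply/val_inj/funext => n; rewrite -[RHS]/(x 0 * (n == 0)%:R).
have [->|n0] := eqVneq n 0; first by rewrite mulr1.
rewrite mulr0; have := congr1 (fun y : l2 R => y n) Ax0.
rewrite /= AE -[RHS]/(0 : R) => /eqP; rewrite mulf_eq0 intr_eq0 (negPf n0) /=.
by move/eqP.
Qed.

(** The perturbation A + E is invertible; if y vanishes at 0, so does the solution x of (A + E) x =
    y, and then A x = y. *)
Lemma diag_range y : coord0 y = 0 <-> exists x, A x = y.
Proof.
split=> [y0|[x <-]]; last by rewrite /= AE mulr0z mul0r.
have [B BE] := opp_operator 1 0 0 1.
have [_ [_ surjB]] : fredholm_s B /\ iso B.
  by apply: (opp_iso BE); rewrite ?add0r ?oner_eq0// expr0n expr1n addr0 ltr01.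
have [x xy] := surjB y; exists x; apply/val_inj/funext => n; rewrite /= AE -xy BE.
have [->|n0] := eqVneq n 0; last by rewrite mulr0; ring.
have : coord0 (B x) = 0 by rewrite xy.
rewrite /= BE oppr0 eqxx mulr0z => /= h; have -> : x 0 = 0 by lra.
ring.
Qed.

Lemma diag_fredholm_s : fredholm_s A.
Proof.
have e00 : coord0 (h1_incl delta0) != 0 by rewrite /= oner_eq0.
have e0 : delta0 != 0.
  by apply: contra_neq e00 => e0; rewrite -[LHS]/(h1_val delta0 0) e0.
split; first exact: rank1_fredholm e0 diag_ker diag_range e00.
have AE' x n : A x n = (1 * n%:~R + 0 + 0 * (n == 0)%:R) * x n +
    0 * `|n%:~R| * x (- n) by rewrite AE; ring.
apply: symmetric_selfadjoint => [x y|w w0|z z0].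
- exact: opp_symmetric AE' x y.
- apply/diag_range.
  have Ad0 : A delta0 = 0 by apply/diag_ker; exists 1; rewrite scale1r.
  have := w0 _ Ad0.
  have -> : dot delta0 w = dot (h1_incl delta0) (w 0 *: h1_incl delta0).
    apply: eq_zsum => n.
    change ((n == 0)%:R * w n = (n == 0)%:R * (w 0 * (n == 0)%:R)).
    by have [->|_] := eqVneq n 0; rewrite ?mul0r// mulr1.
  rewrite dotZr => /eqP; rewrite mulf_eq0 => /orP[/eqP//|/eqP/dot_eq0 h].
  by rewrite h /= eqxx in e00.
- pose u : l2 R := z + - z 0 *: h1_incl delta0.
  have uE n : u n = z n - z 0 * (n == 0)%:R.
    by rewrite -[LHS]/(z n + - z 0 * (n == 0)%:R) mulNr.
  have /diag_range[x xu] : coord0 u = 0.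
    by rewrite -[LHS]/(u 0) uE eqxx mulr1 subrr.
  (* Since [u] vanishes at 0, its product with itself equals its product with [z], which is zero
     because [u] is in the image of [A]. *)
  have u0 : u = 0.
    apply: dot_eq0; rewrite -(z0 x) xu; apply: eq_zsum => n; rewrite uE.
    by have [->|_] := eqVneq n 0; rewrite ?mulr0 ?subr0// mulr1 subrr !mul0r.
  exists (z 0 *: delta0); split; last by apply/diag_ker; exists (z 0).
  apply/val_inj/funext => n; have /(congr1 (fun y : l2 R => y n)) := u0.
  rewrite uE -[RHS]/(0 : R) => /eqP; rewrite subr_eq0 => /eqP zn.
  exact: esym zn.
Qed.

End Crossing.
End SelfAdjointOperators.

(** * The loop of self-adjoint operators and the contradiction *)

Theorem proposition5p7 (R : realType) :
  ~ orientable (restriction (det_bundle (h1 R) (l2 R)) (@fredholm_s R)).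
Proof.
move=> [o [oA o_chart]].
pose good : set (blin (h1 R) (l2 R)) :=
  @fredholm R (h1 R) (l2 R) `&` @fredholm_s R.
have goodF : good `<=` @fredholm R (h1 R) (l2 R) by move=> D [].
have goodI D : fredholm_s D /\ iso D -> good D /\ iso D.
  by move=> [sD isoD]; split=> //; split=> //; exact: iso_fredholm.
pose same_sign := same_sign_segment goodF oA o_chart.
have combE (r s : R) (D0 D1 : blin (h1 R) (l2 R)) x n :
    (r *: D0 + s *: D1) x n = r * D0 x n + s * D1 x n.
  by rewrite blin_combE l2_combE.
have [A AE'] := @opp_operator R 1 0 0 0.
have AE x n : A x n = n%:~R * x n by rewrite AE'; ring.
have [E EE'] := @opp_operator R 0 0 0 1.
have EE x n : E x n = (n == 0)%:R * x n by rewrite EE'; ring.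
have ADE (t : R) x n : (A + t *: E) x n = (n%:~R + t * (n == 0)%:R) * x n.
  by rewrite -[A]scale1r combE AE EE; ring.
have [e e0 cross] : exists2 t : R, 0 < t &
    det_coord (o (A + t *: E)) * det_coord (o (A + - t *: E)) < 0.
  apply: (opposite_sign_crossing goodF oA o_chart (ell := coord0) (e := delta0)).
  - by move=> x /(diag_ker AE).
  - exact: diag_range AE.
  - by rewrite /= EE /= mulr1 oner_eq0.
  - by have [? ?] := diag_fredholm_s AE; split.
  - move=> t t0; apply/goodI/(@opp_iso _ 1 0 0 t) => [x n||].
    + by rewrite ADE; ring.
    + by rewrite add0r.
    + by rewrite expr1n !expr0n addr0 ltr01.
(* The intermediate vertices of the polygon: S1 = 2 A + 1, S2 = J, S3 = - (2 A + 1), S4 = - A - e E,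
   S5 = J' - e E. *)
have [S1 S1E] := @flip_operator R 1 0.
have [S2 S2E] := @flip_operator R 0 1.
have [S3 S3E] := @flip_operator R (-1) 0.
have [S4 S4E] := @opp_operator R (-1) 0 0 (- e).
have [S5 S5E] := @opp_operator R 0 1 0 (- e).
have e2 : 0 < e ^+ 2 by rewrite exprn_gt0.
have s01 : 0 < det_coord (o (A + e *: E)) * det_coord (o S1).
  apply: same_sign => t /andP[t0 t1]; apply/goodI.
  apply: (@opp_iso _ (1 + t) 0 t ((1 - t) * e)) => [x n||].
  - by rewrite combE ADE S1E; ring.
  - by apply: lt0r_neq0; nra.
  - by nra.
(* J anticommutes with 2 A + 1, so 2 A + 1 can be turned into its negative through J without losing
   invertibility. *)
have s12 : 0 < det_coord (o S1) * det_coord (o S2).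
  apply: same_sign => t /andP[t0 t1]; apply/goodI.
  apply: (@flip_iso _ (1 - t) t) => [x n|]; last by nra.
  by rewrite combE S1E S2E; ring.
have s23 : 0 < det_coord (o S2) * det_coord (o S3).
  apply: same_sign => t /andP[t0 t1]; apply/goodI.
  apply: (@flip_iso _ (- t) (1 - t)) => [x n|]; last by nra.
  by rewrite combE S2E S3E; ring.
have s34 : 0 < det_coord (o S3) * det_coord (o S4).
  apply: same_sign => t /andP[t0 t1]; apply/goodI.
  apply: (@opp_iso _ (- (2 - t)) 0 (- (1 - t)) (- (t * e))) => [x n||].
  - by rewrite combE S3E S4E; ring.
  - by rewrite -opprD oppr_eq0; apply: lt0r_neq0; nra.
  - by nra.
(* Here and on the last side e_0 keeps the eigenvalue - e, while on the other coordinates - A is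
   turned into A through the anticommuting J'. *)
have s45 : 0 < det_coord (o S4) * det_coord (o S5).
  apply: same_sign => t /andP[t0 t1]; apply/goodI.
  apply: (@opp_iso _ (- (1 - t)) t 0 (- e)) => [x n||].
  - by rewrite combE S4E S5E; ring.
  - by rewrite add0r oppr_eq0 lt0r_neq0.
  - by nra.
have s56 : 0 < det_coord (o S5) * det_coord (o (A + - e *: E)).
  apply: same_sign => t /andP[t0 t1]; apply/goodI.
  apply: (@opp_iso _ t (1 - t) 0 (- e)) => [x n||].
  - by rewrite combE S5E ADE; ring.
  - by rewrite add0r oppr_eq0 lt0r_neq0.
  - by nra.
(* Along the polygon all signs agree, so the product that is negative by the crossing would have a
   square as its sign. *)
move: cross; rewrite -sgr_lt0 sgrM (sgr_same s01) (sgr_same s12) (sgr_same s23).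
rewrite (sgr_same s34) (sgr_same s45) (sgr_same s56).
by rewrite -expr2 ltNge sqr_ge0.
Qed.
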